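(* (The PBW theorem for rational Cherednik algebras.) Let $\mathfrak h$ be a finite-dimensional complex vector space, $G\subset\mathrm{GL}(\mathfrak h)$ a finite subgroup, $\mathcal S\subset G$ the set of complex reflections, and $c:\mathcal S\to\mathbb C$ a conjugation-invariant function. Let $H_c$ be the rational Cherednik algebra over $\mathbb C[\hbar]$, and for $t\in\mathbb C$ let $H_{t,c}=H_c/(\hbar-t)$. Filter $H_c$ and $H_{t,c}$ by setting $\deg y=1$ for $y\in\mathfrak h$, and $\deg x=\deg g=0$ for $x\in\mathfrak h^*$, $g\in G$. Then the natural surjective homomorphisms $$\xi:\mathbb CG\ltimes\mathbb C[\mathfrak h\oplus\mathfrak h^*][\hbar]\to\mathrm{gr}(H_c),\qquad \xi_t:\mathbb CG\ltimes\mathbb C[\mathfrak h\oplus\mathfrak h^*]\to\mathrm{gr}(H_{t,c})\quad(t\in\mathbb C)$$ are isomorphisms.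
   Context: A complex reflection is a semisimple element $s\in\mathrm{GL}(\mathfrak h)$ with $\operatorname{rank}(1-s)=1$. For $s\in\mathcal S$, $\alpha_s\in\mathfrak h^*$ satisfies $s\alpha_s=\lambda_s\alpha_s$, $\lambda_s\neq1$, and $\alpha_s^\vee\in\mathfrak h$ satisfies $s\alpha_s^\vee=\lambda_s^{-1}\alpha_s^\vee$, with $\langle\alpha_s,\alpha_s^\vee\rangle=2$. The rational Cherednik algebra $H_c=H_c(G,\mathfrak h)$ is the quotient of $\mathbb CG\ltimes\mathbf T(\mathfrak h\oplus\mathfrak h^* )[\hbar]$ ($\mathbf T$ = tensor algebra) by the relations $[x,x']=0$, $[y,y']=0$, $[y,x]=\hbar(y,x)-\sum_{s\in\mathcal S}c_s(y,\alpha_s)(x,\alpha_s^\vee)s$ for $x,x'\in\mathfrak h^*$, $y,y'\in\mathfrak h$. The parameter $\hbar$ has filtration degree $0$. $\mathbb C[\mathfrak h\oplus\mathfrak h^*]=S\mathfrak h^*\otimes S\mathfrak h$, and $\xi,\xi_t$ send $g$, $x$, $y$ to the classes of the corresponding generators. *)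

(* Defs.v *)
From HB Require Import structures.
From mathcomp Require Import all_boot all_order all_fingroup all_algebra.
From mathcomp Require Import finmap generic_quotient ring_quotient.
From mathcomp Require Import boolp functions reals.
From mathcomp.multinomials Require Import monalg.
From mathcomp.real_closed Require Import complex.

Set Implicit Arguments.
Unset Strict Implicit.
Unset Printing Implicit Defensive.

Import GRing.Theory.
Local Open Scope ring_scope.
Local Open Scope quotient_scope.

Section TwoSidedQuotient.
Variables (R : pzRingType) (r : R -> Prop).

Inductive two_sided_ideal : R -> Prop :=
| tsi_gen a x b : r x -> two_sided_ideal (a * x * b)
| tsi_zero : two_sided_ideal 0
| tsi_sub x y : two_sided_ideal x -> two_sided_ideal y ->
    two_sided_ideal (x - y).

Lemma tsi_rel x : r x -> two_sided_ideal x.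
Proof. by move=> rx; have := tsi_gen 1 1 rx; rewrite mul1r mulr1. Qed.

Lemma tsi_mull a x : two_sided_ideal x -> two_sided_ideal (a * x).
Proof.
elim=> [b y d ry||y z _ hy _ hz].
- by rewrite !mulrA; apply: tsi_gen.
- by rewrite mulr0; apply: tsi_zero.
- by rewrite mulrBr; apply: tsi_sub.
Qed.

Lemma tsi_mulr a x : two_sided_ideal x -> two_sided_ideal (x * a).
Proof.
elim=> [b y d ry||y z _ hy _ hz].
- by rewrite -!mulrA mulrA; apply: tsi_gen.
- by rewrite mul0r; apply: tsi_zero.
- by rewrite mulrBl; apply: tsi_sub.
Qed.

Definition tsi_pred : {pred R} := fun x => `[< two_sided_ideal x >].

Lemma tsi_zmod_closed : zmod_closed tsi_pred.
Proof.
split; first by apply/asboolP/tsi_zero.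
by move=> x y /asboolP hx /asboolP hy; apply/asboolP/tsi_sub.
Qed.

HB.instance Definition _ := GRing.isZmodClosed.Build R tsi_pred tsi_zmod_closed.

Definition rquot : Type := Quotient.quot tsi_pred.

HB.instance Definition _ := GRing.Zmodule.on rquot.

Definition rquot_proj (x : R) : rquot := \pi_(Quotient.quot tsi_pred) x.

Lemma rquot_projP x y : rquot_proj x = rquot_proj y <-> two_sided_ideal (x - y).
Proof.
split.
- move=> e; apply/asboolP.
  have := Quotient.idealrBE tsi_pred x y; rewrite unfold_in => ->.
  by apply/eqP.
- move=> /asboolP h; apply/eqP.
  by have := Quotient.idealrBE tsi_pred x y; rewrite unfold_in h => /esym.
Qed.

Lemma rquot_ind (P : rquot -> Prop) :
  (forall x, P (rquot_proj x)) -> forall q, P q.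
Proof. by move=> H q; have := H (repr q); rewrite /rquot_proj reprK. Qed.

Fact rquot_key : unit. Proof. by []. Qed.
Definition rquot_mul :=
  locked_with rquot_key (fun p q : rquot => rquot_proj (repr p * repr q)).

Lemma repr_projP x : two_sided_ideal (repr (rquot_proj x) - x).
Proof. by apply/rquot_projP; rewrite /rquot_proj reprK. Qed.

Lemma rquot_projM x y :
  rquot_mul (rquot_proj x) (rquot_proj y) = rquot_proj (x * y).
Proof.
rewrite /rquot_mul unlock; apply/rquot_projP; set x' := repr _; set y' := repr _.
have -> : x' * y' - x * y = (x' - x) * y' - (x * (y - y')).
  by rewrite mulrBl mulrBr opprB addrA subrK.
apply: tsi_sub; first exact/tsi_mulr/repr_projP.
by apply: tsi_mull; rewrite -opprB -[X in two_sided_ideal X]add0r;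
  apply: tsi_sub; [exact: tsi_zero|exact: repr_projP].
Qed.

Lemma rquot_projB : zmod_morphism rquot_proj.
Proof. by move=> x y; rewrite /rquot_proj /= !piE. Qed.

HB.instance Definition _ :=
  GRing.isZmodMorphism.Build R rquot rquot_proj rquot_projB.

Lemma rquot_mulA : associative rquot_mul.
Proof.
by elim/rquot_ind=> x; elim/rquot_ind=> y; elim/rquot_ind=> z;
  rewrite !rquot_projM mulrA.
Qed.
Lemma rquot_mul1 : left_id (rquot_proj 1) rquot_mul.
Proof. by elim/rquot_ind=> x; rewrite rquot_projM mul1r. Qed.
Lemma rquot_1mul : right_id (rquot_proj 1) rquot_mul.
Proof. by elim/rquot_ind=> x; rewrite rquot_projM mulr1. Qed.
Lemma rquot_mulDl : left_distributive rquot_mul +%R.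
Proof.
elim/rquot_ind=> x; elim/rquot_ind=> y; elim/rquot_ind=> z.
by rewrite -raddfD !rquot_projM -raddfD mulrDl.
Qed.
Lemma rquot_mulDr : right_distributive rquot_mul +%R.
Proof.
elim/rquot_ind=> x; elim/rquot_ind=> y; elim/rquot_ind=> z.
by rewrite -raddfD !rquot_projM -raddfD mulrDr.
Qed.

HB.instance Definition _ := GRing.Zmodule_isPzRing.Build rquot
  rquot_mulA rquot_mul1 rquot_1mul rquot_mulDl rquot_mulDr.

Lemma rquot_proj_monoid_morphism : monoid_morphism rquot_proj.
Proof. by split=> // x y; rewrite -rquot_projM. Qed.

HB.instance Definition _ :=
  GRing.isMonoidMorphism.Build R rquot rquot_proj rquot_proj_monoid_morphism.

Section Lift.
Variables (S : pzRingType) (f : {rmorphism R -> S}).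
Hypothesis f_r : forall x, r x -> f x = 0.

Definition rquot_lift of (forall x, r x -> f x = 0) : rquot -> S :=
  fun q => f (repr q).

Lemma tsi_ker x : two_sided_ideal x -> f x = 0.
Proof.
elim=> [a y b ry||y z _ hy _ hz]; first by rewrite !rmorphM (f_r ry) mulr0 mul0r.
- by rewrite rmorph0.
- by rewrite rmorphB hy hz subr0.
Qed.

Lemma rquot_liftE x : rquot_lift f_r (rquot_proj x) = f x.
Proof.
by apply/eqP; rewrite -subr_eq0 -rmorphB; apply/eqP/tsi_ker/repr_projP.
Qed.

Lemma rquot_liftB : zmod_morphism (rquot_lift f_r).
Proof.
by elim/rquot_ind=> x; elim/rquot_ind=> y; rewrite -rmorphB !rquot_liftE rmorphB.
Qed.
Lemma rquot_liftM : monoid_morphism (rquot_lift f_r).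
Proof.
split; first by rewrite -[1]/(rquot_proj 1) rquot_liftE rmorph1.
by elim/rquot_ind=> x; elim/rquot_ind=> y; rewrite -rmorphM !rquot_liftE rmorphM.
Qed.
HB.instance Definition _ :=
  GRing.isZmodMorphism.Build rquot S (rquot_lift f_r) rquot_liftB.
HB.instance Definition _ :=
  GRing.isMonoidMorphism.Build rquot S (rquot_lift f_r) rquot_liftM.
End Lift.

End TwoSidedQuotient.

Arguments rquot {R} r.
Arguments rquot_proj {R} r x.

Section FreeLift.
Variables (K : fieldType) (X : choiceType) (B : nzRingType).
Variables (sc : {rmorphism K -> B}) (phi : X -> B).
Hypothesis scC : forall a b, GRing.comm (sc a) b.

Definition word_prod (m : {fmonom X}) : B := \prod_(v <- m) phi v.

Lemma word_prod_morph : mmorphism word_prod.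
Proof.
split; last by rewrite /word_prod fm1 big_nil.
by move=> x y; rewrite /word_prod fmM big_cat.
Qed.
HB.instance Definition _ := isMultiplicative.Build _ _ word_prod word_prod_morph.

Definition free_lift of (forall a b, GRing.comm (sc a) b) :
  {malg K[{fmonom X}]} -> B := mmap sc word_prod.

Lemma free_liftB : zmod_morphism (free_lift scC).
Proof. exact: raddfB. Qed.
Lemma free_liftM : monoid_morphism (free_lift scC).
Proof.
have [hM h1] := commr_mmap_is_multiplicative (f := sc) (h := word_prod)
  (fun g m m' => scC _ _).
by split.
Qed.
HB.instance Definition _ :=
  GRing.isZmodMorphism.Build {malg K[{fmonom X}]} B (free_lift scC) free_liftB.
HB.instance Definition _ :=
  GRing.isMonoidMorphism.Build {malg K[{fmonom X}]} B (free_lift scC) free_liftM.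

Lemma free_liftC a : free_lift scC a%:MP = sc a.
Proof. exact: mmapC. Qed.

Lemma free_liftU v : free_lift scC << 1 *g fmu v >> = phi v.
Proof. by rewrite /free_lift mmapU /= rmorph1 mul1r /word_prod fmU big_seq1. Qed.

End FreeLift.

Lemma free_ext (K : fieldType) (X : choiceType) (B : pzRingType)
    (f g : {rmorphism {malg K[{fmonom X}]} -> B}) :
  (forall a, f a%:MP = g a%:MP) ->
  (forall v, f << 1 *g fmu v >> = g << 1 *g fmu v >>) -> f =1 g.
Proof.
move=> hC hU p; rewrite [p]monalgE !rmorph_sum; apply: eq_bigr => m _.
have -> : << p@_m *g m >> = (p@_m)%:MP * << m >> :> {malg K[{fmonom X}]}.
  by rewrite malgM_def fgmulUU mulr1 mul1m.
rewrite !rmorphM hC; congr (_ * _).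
case: m => s; elim: s => [|v s ih].
  have -> : << FMonom [::] >> = 1 :> {malg K[{fmonom X}]}.
    by rewrite -fmoneE.
  by rewrite !rmorph1.
have -> : << FMonom (v :: s) >> = << fmu v >> * << FMonom s >> :> {malg K[{fmonom X}]}.
  rewrite malgM_def fgmulUU mulr1; congr << _ >>.
  by apply/eqP; rewrite fmP fmM fmuE.
by rewrite !rmorphM hU ih.
Qed.

Section TensorAlgebra.
Variables (K : fieldType) (V : lmodType K).

Local Notation free := {malg K[{fmonom V}]}.

Definition free_var (v : V) : free := << 1 *g fmu v >>.

Inductive tens_rel : free -> Prop :=
| tens_lin a v w :
    tens_rel (free_var (a *: v + w) - (a *: free_var v + free_var w)).

Definition tens : Type := rquot tens_rel.
HB.instance Definition _ := GRing.PzRing.on tens.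

Definition tens_scal (a : K) : tens := rquot_proj tens_rel a%:MP.
Definition tens_var (v : V) : tens := rquot_proj tens_rel (free_var v).

Lemma tens_scalB : zmod_morphism tens_scal.
Proof. by move=> a b; rewrite /tens_scal !rmorphB. Qed.
Lemma tens_scalM : monoid_morphism tens_scal.
Proof. by split=> [|a b]; rewrite /tens_scal; [rewrite rmorph1|rewrite 2!rmorphM]. Qed.
HB.instance Definition _ :=
  GRing.isZmodMorphism.Build K tens tens_scal tens_scalB.
HB.instance Definition _ :=
  GRing.isMonoidMorphism.Build K tens tens_scal tens_scalM.

Lemma free_scalC a (x : free) : a%:MP * x = x * a%:MP.
Proof.
apply: (proj1 (malgP (a%:MP * x) (x * a%:MP))) => m; rewrite (mcoeffCM a x m).
rewrite [x in RHS]monalgE mulr_suml [x in LHS]monalgE !raddf_sum /= mulr_sumr.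
apply: eq_bigr => k _.
by rewrite (malgM_def << _ *g k >>) fgmulUU mulm1 !mcoeffU mulrC mulrnAl.
Qed.

Lemma tens_scalC a (x : tens) : GRing.comm (tens_scal a) x.
Proof.
elim/rquot_ind: x => x; rewrite /GRing.comm /tens_scal.
by rewrite -!(rmorphM (rquot_proj tens_rel)) free_scalC.
Qed.

Lemma tens_var_lin a v w :
  tens_var (a *: v + w) = tens_scal a * tens_var v + tens_var w.
Proof.
rewrite /tens_var /tens_scal -rmorphM -rmorphD mul_malgC.
by apply/rquot_projP/tsi_rel.
Qed.

Lemma tens_ext (B : pzRingType) (f g : {rmorphism tens -> B}) :
  (forall a, f (tens_scal a) = g (tens_scal a)) ->
  (forall v, f (tens_var v) = g (tens_var v)) -> f =1 g.
Proof.
move=> hC hU; elim/rquot_ind=> x.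
by apply: (@free_ext _ _ _ (f \o rquot_proj tens_rel) (g \o rquot_proj tens_rel)).
Qed.

Section Lift.
Variables (B : nzRingType) (sc : {rmorphism K -> B}) (phi : V -> B).
Hypothesis scC : forall a b, GRing.comm (sc a) b.
Hypothesis phi_lin : forall a v w, phi (a *: v + w) = sc a * phi v + phi w.

Lemma tens_lift_subproof x : tens_rel x -> free_lift phi scC x = 0.
Proof.
case=> a v w; rewrite rmorphB rmorphD -mul_malgC rmorphM /= free_liftC.
by rewrite !free_liftU phi_lin subrr.
Qed.

Definition tens_lift : {rmorphism tens -> B} := rquot_lift tens_lift_subproof.

Lemma tens_lift_scal a : tens_lift (tens_scal a) = sc a.
Proof. by apply: etrans (rquot_liftE tens_lift_subproof _) _; exact: free_liftC. Qed.
Lemma tens_lift_var v : tens_lift (tens_var v) = phi v.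
Proof. by apply: etrans (rquot_liftE tens_lift_subproof _) _; exact: free_liftU. Qed.
End Lift.

Lemma tens_aug_lin a (v w : V) : 0 = (a : K) * 0 + 0 :> K.
Proof. by rewrite mulr0 addr0. Qed.

Lemma tens1_neq0 : 1 != 0 :> tens.
Proof.
pose f := tens_lift (sc := idfun) (fun a b => mulrC a b) tens_aug_lin.
apply/eqP => e; have := congr1 (fun x : tens => f x) e.
by rewrite rmorph1 rmorph0 => /eqP; rewrite oner_eq0.
Qed.
HB.instance Definition _ := GRing.PzSemiRing_isNonZero.Build tens tens1_neq0.

End TensorAlgebra.

(* For V = h (+) h^*, canonically identified with its own dual, sym V is the ring
   of polynomial functions on h (+) h^*. *)
Section SymmetricAlgebra.
Variables (K : fieldType) (V : lmodType K).

Inductive sym_rel : tens V -> Prop :=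
| sym_comm v w :
    sym_rel (tens_var v * tens_var w - tens_var w * tens_var v).

Definition sym : Type := rquot sym_rel.
HB.instance Definition _ := GRing.PzRing.on sym.

Definition sym_scal (a : K) : sym := rquot_proj sym_rel (tens_scal V a).
Definition sym_var (v : V) : sym := rquot_proj sym_rel (tens_var v).

Lemma sym_scalB : zmod_morphism sym_scal.
Proof. by move=> a b; rewrite /sym_scal !rmorphB. Qed.
Lemma sym_scalM : monoid_morphism sym_scal.
Proof. by split=> [|a b]; rewrite /sym_scal; [rewrite rmorph1|rewrite 2!rmorphM]. Qed.
HB.instance Definition _ :=
  GRing.isZmodMorphism.Build K sym sym_scal sym_scalB.
HB.instance Definition _ :=
  GRing.isMonoidMorphism.Build K sym sym_scal sym_scalM.

Lemma sym_scalC a (x : sym) : GRing.comm (sym_scal a) x.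
Proof.
elim/rquot_ind: x => x; rewrite /GRing.comm /sym_scal -!rmorphM /=.
by rewrite (tens_scalC a x).
Qed.

Lemma sym_var_lin a v w :
  sym_var (a *: v + w) = sym_scal a * sym_var v + sym_var w.
Proof. by rewrite /sym_var tens_var_lin rmorphD rmorphM. Qed.

Lemma sym_varC v w : sym_var v * sym_var w = sym_var w * sym_var v.
Proof.
rewrite /sym_var -[LHS](rmorphM (rquot_proj sym_rel)).
rewrite -[RHS](rmorphM (rquot_proj sym_rel)).
by have h := tsi_rel (sym_comm v w); apply/rquot_projP.
Qed.

Lemma sym_ext (B : pzRingType) (f g : {rmorphism sym -> B}) :
  (forall a, f (sym_scal a) = g (sym_scal a)) ->
  (forall v, f (sym_var v) = g (sym_var v)) -> f =1 g.
Proof.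
move=> hC hU; elim/rquot_ind=> x.
by apply: (@tens_ext _ _ _ (f \o rquot_proj sym_rel) (g \o rquot_proj sym_rel)).
Qed.

Section Lift.
Variables (B : nzRingType) (sc : {rmorphism K -> B}) (phi : V -> B).
Hypothesis scC : forall a b, GRing.comm (sc a) b.
Hypothesis phi_lin : forall a v w, phi (a *: v + w) = sc a * phi v + phi w.
Hypothesis phiC : forall v w, phi v * phi w = phi w * phi v.

Lemma sym_lift_subproof x : sym_rel x -> tens_lift scC phi_lin x = 0.
Proof.
case=> v w; rewrite (rmorphB (tens_lift scC phi_lin)).
rewrite !(rmorphM (tens_lift scC phi_lin)) !tens_lift_var.
by rewrite phiC subrr.
Qed.

Definition sym_lift : {rmorphism sym -> B} := rquot_lift sym_lift_subproof.

Lemma sym_lift_scal a : sym_lift (sym_scal a) = sc a.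
Proof.
by apply: etrans (rquot_liftE sym_lift_subproof _) _; apply: tens_lift_scal.
Qed.
Lemma sym_lift_var v : sym_lift (sym_var v) = phi v.
Proof.
by apply: etrans (rquot_liftE sym_lift_subproof _) _; apply: tens_lift_var.
Qed.
End Lift.

Lemma sym1_neq0 : 1 != 0 :> sym.
Proof.
pose f := sym_lift (sc := idfun) (fun a b => mulrC a b) (@tens_aug_lin K V)
  (fun v w => erefl).
apply/eqP => e; have := congr1 (fun x : sym => f x) e.
by rewrite rmorph1 rmorph0 => /eqP; rewrite oner_eq0.
Qed.
HB.instance Definition _ := GRing.PzSemiRing_isNonZero.Build sym sym1_neq0.

End SymmetricAlgebra.

Record ring_action (gT : finGroupType) (A : nzRingType) := RingAction {
  ract :> gT -> {rmorphism A -> A};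
  ract1 : ract 1%g =1 idfun;
  ractM : forall g h, ract (g * h)%g =1 ract g \o ract h }.

(* The function f stands for the sum of (f g) g over g, with g a = (act g a) g. *)
Definition smash (gT : finGroupType) (A : nzRingType) (act : ring_action gT A)
  : Type := {ffun gT -> A}.

Section SmashProduct.
Variables (gT : finGroupType) (A : nzRingType) (act : ring_action gT A).

Local Notation smash := (smash act).

HB.instance Definition _ := GRing.Zmodule.on smash.

Implicit Types f : smash.

Definition smash_mul f1 f2 : smash :=
  [ffun k => \sum_g f1 g * act g (f2 (g^-1 * k)%g)].

Definition smash_emb (a : A) : smash := [ffun g => if g == 1%g then a else 0].
Definition smash_grp (g : gT) : smash := [ffun h => (h == g)%:R].

Lemma smash_mul_grp g f k : smash_mul (smash_grp g) f k = act g (f (g^-1 * k)%g).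
Proof.
rewrite ffunE (bigD1 g) //= ffunE eqxx mul1r big1 ?addr0 // => h /negbTE nhg.
by rewrite ffunE nhg mul0r.
Qed.

Lemma smash_mulA : associative smash_mul.
Proof.
move=> f1 f2 f3; apply/ffunP=> k; rewrite !ffunE.
under [RHS]eq_bigr => g _ do rewrite ffunE mulr_suml.
rewrite exchange_big /=; apply: eq_bigr => h _.
rewrite ffunE raddf_sum mulr_sumr /= [RHS](reindex_inj (mulgI h)) /=.
apply: eq_bigr => g _.
by rewrite mulKg rmorphM mulrA ractM /= invMg !mulgA.
Qed.

Lemma smash_mul1 : left_id (smash_grp 1%g) smash_mul.
Proof. by move=> f; apply/ffunP=> k; rewrite smash_mul_grp ract1 invg1 mul1g. Qed.

Lemma smash_1mul : right_id (smash_grp 1%g) smash_mul.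
Proof.
move=> f; apply/ffunP=> k; rewrite ffunE (bigD1 k) //= ffunE mulVg eqxx.
rewrite rmorph1 mulr1 big1 ?addr0 // => h nhk.
rewrite ffunE -(inj_eq (mulgI h)) mulKVg mulg1 eq_sym (negbTE nhk).
by rewrite rmorph0 mulr0.
Qed.

Lemma smash_mulDl : left_distributive smash_mul +%R.
Proof.
move=> f1 f2 f3; apply/ffunP=> k; rewrite !ffunE -big_split /=.
by apply: eq_bigr => g _; rewrite ffunE mulrDl.
Qed.

Lemma smash_mulDr : right_distributive smash_mul +%R.
Proof.
move=> f1 f2 f3; apply/ffunP=> k; rewrite !ffunE -big_split /=.
by apply: eq_bigr => g _; rewrite ffunE rmorphD mulrDr.
Qed.

Lemma smash1_neq0 : smash_grp 1%g != 0.
Proof.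
apply/eqP => /ffunP /(_ 1%g); rewrite !ffunE eqxx => /eqP.
by rewrite oner_eq0.
Qed.

HB.instance Definition _ := GRing.Zmodule_isNzRing.Build smash
  smash_mulA smash_mul1 smash_1mul smash_mulDl smash_mulDr smash1_neq0.

End SmashProduct.

Record finGL (K : fieldType) (h : vectType K) := FinGL {
  gl_elts : seq 'End(h);
  gl_inj : {in gl_elts, forall f, lker f == 0%VS};
  gl_one : \1%VF \in gl_elts;
  gl_mul : {in gl_elts &, forall f g, (f \o g)%VF \in gl_elts};
  gl_inv : {in gl_elts, forall f, f^-1%VF \in gl_elts} }.

Section FinGLGroup.
Variables (K : fieldType) (h : vectType K) (G : finGL h).

Definition gl_type : Type := seq_sub (gl_elts G).
HB.instance Definition _ := Finite.on gl_type.

Definition gl_val (g : gl_type) : 'End(h) := ssval g.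

Definition glM (f g : gl_type) : gl_type :=
  SeqSub (gl_mul (ssvalP f) (ssvalP g)).
Definition gl1 : gl_type := SeqSub (gl_one G).
Definition glV (f : gl_type) : gl_type := SeqSub (gl_inv (ssvalP f)).

Lemma glMA : associative glM.
Proof. by move=> f g k; apply: val_inj; rewrite /= comp_lfunA. Qed.
Lemma gl1M : left_id gl1 glM.
Proof. by move=> f; apply: val_inj; rewrite /= comp_lfun1l. Qed.
Lemma glVM : left_inverse gl1 glV glM.
Proof.
by move=> f; apply: val_inj; rewrite /= lker0_compVf // (gl_inj (ssvalP f)).
Qed.

HB.instance Definition _ := Finite_isGroup.Build gl_type glMA gl1M glVM.

Lemma gl_val1 : gl_val 1%g = \1%VF. Proof. by []. Qed.
Lemma gl_valM f g : gl_val (f * g)%g = (gl_val f \o gl_val g)%VF.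
Proof. by []. Qed.
Lemma gl_valV f : gl_val f^-1%g = (gl_val f)^-1%VF. Proof. by []. Qed.

End FinGLGroup.

Coercion gl_type : finGL >-> Sortclass.

Arguments smash_emb {gT A} act a.
Arguments smash_grp {gT A} act g.

Section Filtration.
Variable R : pzRingType.

Record filtration := Filtration {
  fil :> nat -> R -> Prop;
  fil1 : fil 0 1;
  filB : forall n x y, fil n x -> fil n y -> fil n (x - y);
  filM : forall m n x y, fil m x -> fil n y -> fil (m + n) (x * y);
  filW : forall m n x, (m <= n)%N -> fil m x -> fil n x }.

Variable F : filtration.

Lemma fil0 n : F n 0.
Proof.
by apply: (@filW F 0) => //; rewrite -(subrr 1); apply: filB; apply: fil1.
Qed.
Lemma filN n x : F n x -> F n (- x).
Proof. by move=> hx; rewrite -[- x]add0r; apply: filB => //; apply: fil0. Qed.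
Lemma filD n x y : F n x -> F n y -> F n (x + y).
Proof. by move=> hx hy; rewrite -[y]opprK; apply: filB => //; apply: filN. Qed.
Lemma fil_sum n (I : Type) (s : seq I) (P : pred I) (f : I -> R) :
  (forall i, P i -> F n (f i)) -> F n (\sum_(i <- s | P i) f i).
Proof. by move=> h; elim/big_rec: _ => [|i x Pi hx]; [exact: fil0|apply: filD; auto]. Qed.

Variable gen : nat -> R -> Prop.

(* The smallest multiplicative filtration in which the elements of gen n have
   degree at most n. *)
Inductive gen_fil_pred : nat -> R -> Prop :=
| gen_fil_gen n x : gen n x -> gen_fil_pred n x
| gen_fil_one : gen_fil_pred 0 1
| gen_fil_sub n x y : gen_fil_pred n x -> gen_fil_pred n y ->
    gen_fil_pred n (x - y)
| gen_fil_mul m n x y : gen_fil_pred m x -> gen_fil_pred n y ->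
    gen_fil_pred (m + n) (x * y)
| gen_fil_weak m n x : (m <= n)%N -> gen_fil_pred m x -> gen_fil_pred n x.

Definition gen_fil := Filtration gen_fil_one gen_fil_sub gen_fil_mul gen_fil_weak.

End Filtration.

(* {poly R} would require 1 != 0 in R, which is not known for the quotient rings
   to which this is applied. *)
Section PowerSeries.
Variable R : pzRingType.

Definition pseries : Type := nat -> R.
HB.instance Definition _ := GRing.Zmodule.copy pseries (nat -> R).

Implicit Types a b c : pseries.

Definition pseries_one : pseries := fun n => (n == 0%N)%:R.
Definition pseries_mul a b : pseries :=
  fun n => \sum_(i < n.+1) a i * b (n - i)%N.

Lemma pseries_mul_rev a b n :
  pseries_mul a b n = \sum_(i < n.+1) a (n - i)%N * b i.
Proof.
rewrite /pseries_mul (reindex_inj rev_ord_inj) /=.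
by apply: eq_bigr => j _; rewrite (sub_ordK j).
Qed.

Lemma pseries_mulA : associative pseries_mul.
Proof.
move=> a b c; apply/funext=> i; rewrite [RHS]pseries_mul_rev.
pose coef3 j k := a j * (b (i - j - k)%N * c k).
transitivity (\sum_(j < i.+1) \sum_(k < i.+1 | (k <= i - j)%N) coef3 j k).
  rewrite {1}/pseries_mul.
  apply: eq_bigr => /= j _; rewrite pseries_mul_rev big_distrr /=.
  by rewrite (big_ord_narrow_leq (leq_subr _ _)).
rewrite (exchange_big_dep predT) //=; apply: eq_bigr => k _.
transitivity (\sum_(j < i.+1 | (j <= i - k)%N) coef3 j k).
  apply: eq_bigl => j; rewrite -ltnS -(ltnS j) -!subSn ?leq_ord //.
  by rewrite -subn_gt0 -(subn_gt0 j) -!subnDA addnC.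
rewrite (big_ord_narrow_leq (leq_subr _ _)) /pseries_mul big_distrl /=.
by apply: eq_bigr => j _; rewrite /coef3 -!subnDA addnC mulrA.
Qed.

Lemma pseries_mul1 : left_id pseries_one pseries_mul.
Proof.
move=> a; apply/funext=> n; rewrite /pseries_mul big_ord_recl /= subn0 mul1r.
by rewrite big1 ?addr0 // => i _; rewrite mul0r.
Qed.
Lemma pseries_1mul : right_id pseries_one pseries_mul.
Proof.
move=> a; apply/funext=> n; rewrite pseries_mul_rev big_ord_recl /= subn0 mulr1.
by rewrite big1 ?addr0 // => i _; rewrite mulr0.
Qed.
Lemma pseries_mulDl : left_distributive pseries_mul +%R.
Proof.
move=> a b c; apply/funext=> n; rewrite /pseries_mul [RHS]/GRing.add /=.
by rewrite -big_split /=; apply: eq_bigr => i _; rewrite -mulrDl.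
Qed.
Lemma pseries_mulDr : right_distributive pseries_mul +%R.
Proof.
move=> a b c; apply/funext=> n; rewrite /pseries_mul [RHS]/GRing.add /=.
by rewrite -big_split /=; apply: eq_bigr => i _; rewrite -mulrDr.
Qed.

HB.instance Definition _ := GRing.Zmodule_isPzRing.Build pseries
  pseries_mulA pseries_mul1 pseries_1mul pseries_mulDl pseries_mulDr.

Lemma pseriesME a b n : (a * b) n = \sum_(i < n.+1) a i * b (n - i)%N.
Proof. by []. Qed.
Lemma pseriesBE a b n : (a - b) n = a n - b n.
Proof. by []. Qed.
Lemma pseries1E n : (1 : pseries) n = (n == 0%N)%:R.
Proof. by []. Qed.

End PowerSeries.

Section AssociatedGraded.
Variables (R : pzRingType) (F : filtration R).

(* The direct sum of the F n, inside the ring of formal power series, so that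
   the associated graded ring is its quotient by the sum of the F n.-1. *)
Definition rees_pred : {pred pseries R} := fun a =>
  `[< (forall n, F n (a n)) /\ (exists N, forall n, (N <= n)%N -> a n = 0) >].

Lemma rees_subring_closed : subring_closed rees_pred.
Proof.
split.
- apply/asboolP; split=> [n|].
  + by rewrite pseries1E; case: n => [|n] /=; [exact: fil1|exact: fil0].
  + by exists 1%N => [[|n]].
- move=> a b /asboolP[Fa [M a0]] /asboolP[Fb [N b0]]; apply/asboolP; split=> [n|].
  + by rewrite pseriesBE; apply: filB.
  + exists (maxn M N) => n; rewrite geq_max => /andP[Mn Nn].
    by rewrite pseriesBE a0 // b0 // subrr.
- move=> a b /asboolP[Fa [M a0]] /asboolP[Fb [N b0]]; apply/asboolP; split=> [n|].
  + rewrite pseriesME; apply: fil_sum => i _.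
    by rewrite -{1}(subnKC (ltnSE (ltn_ord i))); apply: filM.
  + exists (M + N)%N => n MNn; rewrite pseriesME big1 // => i _.
    have [Mi|iM] := leqP M i; first by rewrite a0 // mul0r.
    rewrite b0 ?mulr0 // leq_subRL ?(ltnSE (ltn_ord i)) //.
    by apply: leq_trans MNn; rewrite leq_add2r ltnW.
Qed.

HB.instance Definition _ :=
  GRing.isSubringClosed.Build (pseries R) rees_pred rees_subring_closed.

Record rees : Type := Rees { rees_val : pseries R; _ : rees_val \in rees_pred }.
HB.instance Definition _ := [isSub for rees_val].
HB.instance Definition _ := [Choice of rees by <:].
HB.instance Definition _ := GRing.SubChoice_isSubPzRing.Build
  (pseries R) rees_pred rees rees_subring_closed.

Definition gr_rel (a : rees) : Prop :=
  rees_val a 0%N = 0 /\ forall n, F n (rees_val a n.+1).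

Definition gr : Type := rquot gr_rel.
HB.instance Definition _ := GRing.PzRing.on gr.

Definition monomial (n : nat) (x : R) : pseries R :=
  fun m => if m == n then x else 0.

Lemma monomial_rees n x : F n x -> monomial n x \in rees_pred.
Proof.
move=> Fx; apply/asboolP; split=> [m|].
- by rewrite /monomial; case: eqP => [->|_] //; apply: fil0.
- by exists n.+1 => m nm; rewrite /monomial gtn_eqF.
Qed.

(* The class of x in F n / F n.-1 (in F 0 when n is 0). *)
Definition gr_class (n : nat) (x : R) (Fx : F n x) : gr :=
  rquot_proj gr_rel (Rees (monomial_rees Fx)).

End AssociatedGraded.

Section Representation.
Variables (K : fieldType) (h : vectType K) (G : finGL h).

Definition dual : vectType K := 'Hom(h, K^o).

Definition gl_dual (g : G) (x : dual) : dual := (x \o (gl_val g)^-1)%VF.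

Definition gl_sum (g : G) (v : h * dual) : h * dual :=
  (gl_val g v.1, gl_dual g v.2).

Lemma gl_sum_lin g a v w : gl_sum g (a *: v + w) = a *: gl_sum g v + gl_sum g w.
Proof.
rewrite /gl_sum /gl_dual /= linearP; congr pair.
by apply/lfunP=> u; rewrite !(comp_lfunE, add_lfunE, scale_lfunE).
Qed.

Lemma gl_sum1 v : gl_sum 1%g v = v.
Proof.
case: v => y x; rewrite /gl_sum /gl_dual gl_val1 /= id_lfunE; congr pair.
by rewrite -[(\1^-1)%VF]comp_lfun1l lker0_compfV ?comp_lfun1r //; exact: (gl_inj (gl_one G)).
Qed.

Lemma gl_sumM f g v : gl_sum (f * g)%g v = gl_sum f (gl_sum g v).
Proof.
case: v => y x; rewrite /gl_sum /gl_dual gl_valM /= comp_lfunE; congr pair.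
have -> : (gl_val f \o gl_val g)^-1%VF = gl_val (f * g)^-1%g by [].
by rewrite invMg gl_valM comp_lfunA.
Qed.

Lemma tens_act_lin g a v w : tens_var (gl_sum g (a *: v + w)) =
  tens_scal _ a * tens_var (gl_sum g v) + tens_var (gl_sum g w).
Proof. by rewrite gl_sum_lin tens_var_lin. Qed.

Definition tens_act g : {rmorphism tens (h * dual) -> tens (h * dual)} :=
  tens_lift (sc := tens_scal _) (@tens_scalC K _) (tens_act_lin g).

Lemma tens_act_scal g a : tens_act g (tens_scal _ a) = tens_scal _ a.
Proof. exact: tens_lift_scal. Qed.
Lemma tens_act_var g v : tens_act g (tens_var v) = tens_var (gl_sum g v).
Proof. exact: tens_lift_var. Qed.

Lemma tens_act1 : tens_act 1%g =1 idfun.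
Proof.
apply: tens_ext => [a|v]; first exact: tens_act_scal.
by rewrite tens_act_var gl_sum1.
Qed.

Lemma tens_actM f g : tens_act (f * g)%g =1 tens_act f \o tens_act g.
Proof.
apply: (@tens_ext _ _ _ _ (tens_act f \o tens_act g)) => [a|v].
  apply: etrans (tens_act_scal _ _) _; apply/esym.
  exact: etrans (congr1 (fun z => tens_act f z) (tens_act_scal g a)) (tens_act_scal f a).
apply: etrans (tens_act_var _ _) _; apply/esym; rewrite gl_sumM.
exact: etrans (congr1 (fun z => tens_act f z) (tens_act_var g v)) (tens_act_var f _).
Qed.

Definition tens_action := RingAction tens_act1 tens_actM.

Lemma sym_act_lin g a v w : sym_var (gl_sum g (a *: v + w)) =
  sym_scal _ a * sym_var (gl_sum g v) + sym_var (gl_sum g w).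
Proof. by rewrite gl_sum_lin sym_var_lin. Qed.

Definition sym_act g : {rmorphism sym (h * dual) -> sym (h * dual)} :=
  sym_lift (sc := sym_scal _) (@sym_scalC K _) (sym_act_lin g)
    (fun v w => sym_varC _ _).

Lemma sym_act_scal g a : sym_act g (sym_scal _ a) = sym_scal _ a.
Proof. exact: sym_lift_scal. Qed.
Lemma sym_act_var g v : sym_act g (sym_var v) = sym_var (gl_sum g v).
Proof. exact: sym_lift_var. Qed.

Lemma sym_act1 : sym_act 1%g =1 idfun.
Proof.
apply: sym_ext => [a|v]; first exact: sym_act_scal.
by rewrite sym_act_var gl_sum1.
Qed.

Lemma sym_actM f g : sym_act (f * g)%g =1 sym_act f \o sym_act g.
Proof.
apply: (@sym_ext _ _ _ _ (sym_act f \o sym_act g)) => [a|v].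
  apply: etrans (sym_act_scal _ _) _; apply/esym.
  exact: etrans (congr1 (fun z => sym_act f z) (sym_act_scal g a)) (sym_act_scal f a).
apply: etrans (sym_act_var _ _) _; apply/esym; rewrite gl_sumM.
exact: etrans (congr1 (fun z => sym_act f z) (sym_act_var g v)) (sym_act_var f _).
Qed.

Definition sym_action := RingAction sym_act1 sym_actM.

Definition semisimple (f : 'End(h)) : Prop :=
  forall U : {vspace h}, (f @: U <= U)%VS ->
    exists W : {vspace h},
      [/\ (f @: W <= W)%VS, (U + W)%VS = fullv & (U :&: W)%VS = 0%VS].

Definition complex_reflection (f : 'End(h)) : Prop :=
  semisimple f /\ \dim (limg (\1 - f)%VF) = 1%N.

Definition reflections : {set G} :=
  [set s : G | `[< complex_reflection (gl_val s) >]].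

Record reflection_roots := ReflectionRoots {
  eigval : G -> K;
  root : G -> dual;
  coroot : G -> h;
  eigval_neq1 : forall s, s \in reflections -> eigval s != 1;
  rootE : forall s, s \in reflections -> gl_dual s (root s) = eigval s *: root s;
  corootE : forall s, s \in reflections ->
    gl_val s (coroot s) = (eigval s)^-1 *: coroot s;
  root_coroot : forall s, s \in reflections -> root s (coroot s) = 2 }.

End Representation.

Section Cherednik.
Variables (K : fieldType) (h : vectType K) (G : finGL h).
Variables (rts : reflection_roots G) (c : G -> K).

Local Notation D := (dual h).
Local Notation V := (h * dual h)%type.

Definition smash_tens : Type := {poly smash (tens_action G)}.
HB.instance Definition _ := GRing.NzRing.on smash_tens.

Definition st_scal (a : K) : smash_tens :=
  (smash_emb (tens_action G) (tens_scal V a))%:P.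
Definition st_grp (g : G) : smash_tens := (smash_grp (tens_action G) g)%:P.
Definition st_x (x : D) : smash_tens :=
  (smash_emb (tens_action G) (tens_var ((0, x) : V)))%:P.
Definition st_y (y : h) : smash_tens :=
  (smash_emb (tens_action G) (tens_var ((y, 0) : V)))%:P.
Definition st_hbar : smash_tens := 'X.

(* The quotients below are not algType's, as these are nontrivial rings by
   definition; scalars are tracked through the image of st_scal. *)
Inductive cherednik_rel : smash_tens -> Prop :=
| rel_xx x x' : cherednik_rel (st_x x * st_x x' - st_x x' * st_x x)
| rel_yy y y' : cherednik_rel (st_y y * st_y y' - st_y y' * st_y y)
| rel_yx y x : cherednik_rel
    (st_y y * st_x x - st_x x * st_y y
     - (st_hbar * st_scal (x y)
        - \sum_(s in reflections G)
            st_scal (c s * root rts s y * x (coroot rts s)) * st_grp s)).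

Definition cherednik : Type := rquot cherednik_rel.
HB.instance Definition _ := GRing.PzRing.on cherednik.

Definition ch_proj : {rmorphism smash_tens -> cherednik} :=
  rquot_proj cherednik_rel.

Inductive ch_gen : nat -> cherednik -> Prop :=
| ch_gen_scal a : ch_gen 0 (ch_proj (st_scal a))
| ch_gen_grp g : ch_gen 0 (ch_proj (st_grp g))
| ch_gen_hbar : ch_gen 0 (ch_proj st_hbar)
| ch_gen_x x : ch_gen 0 (ch_proj (st_x x))
| ch_gen_y y : ch_gen 1 (ch_proj (st_y y)).

Definition ch_fil : filtration cherednik := gen_fil ch_gen.

Variable t : K.

Inductive hbar_rel : cherednik -> Prop :=
| hbar_eq : hbar_rel (ch_proj (st_hbar - st_scal t)).

Definition cherednik_at : Type := rquot hbar_rel.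
HB.instance Definition _ := GRing.PzRing.on cherednik_at.

Definition cht_proj : {rmorphism smash_tens -> cherednik_at} :=
  rquot_proj hbar_rel \o ch_proj.

Inductive cht_gen : nat -> cherednik_at -> Prop :=
| cht_gen_scal a : cht_gen 0 (cht_proj (st_scal a))
| cht_gen_grp g : cht_gen 0 (cht_proj (st_grp g))
| cht_gen_x x : cht_gen 0 (cht_proj (st_x x))
| cht_gen_y y : cht_gen 1 (cht_proj (st_y y)).

Definition cht_fil : filtration cherednik_at := gen_fil cht_gen.

Definition ss_scal (a : K) := smash_emb (sym_action G) (sym_scal V a).
Definition ss_grp (g : G) := smash_grp (sym_action G) g.
Definition ss_x (x : D) := smash_emb (sym_action G) (sym_var ((0, x) : V)).
Definition ss_y (y : h) := smash_emb (sym_action G) (sym_var ((y, 0) : V)).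

Record natural_map (xi : {poly smash (sym_action G)} -> gr ch_fil) : Prop := {
  nat_scal a : xi (ss_scal a)%:P = gr_class (F := ch_fil) (gen_fil_gen (ch_gen_scal a));
  nat_grp g : xi (ss_grp g)%:P = gr_class (F := ch_fil) (gen_fil_gen (ch_gen_grp g));
  nat_hbar : xi 'X = gr_class (F := ch_fil) (gen_fil_gen ch_gen_hbar);
  nat_x x : xi (ss_x x)%:P = gr_class (F := ch_fil) (gen_fil_gen (ch_gen_x x));
  nat_y y : xi (ss_y y)%:P = gr_class (F := ch_fil) (gen_fil_gen (ch_gen_y y)) }.

Record natural_map_at (xi : smash (sym_action G) -> gr cht_fil) : Prop := {
  natt_scal a : xi (ss_scal a) = gr_class (F := cht_fil) (gen_fil_gen (cht_gen_scal a));
  natt_grp g : xi (ss_grp g) = gr_class (F := cht_fil) (gen_fil_gen (cht_gen_grp g));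
  natt_x x : xi (ss_x x) = gr_class (F := cht_fil) (gen_fil_gen (cht_gen_x x));
  natt_y y : xi (ss_y y) = gr_class (F := cht_fil) (gen_fil_gen (cht_gen_y y)) }.

End Cherednik.

(* Main.v *)
(* The algebra G |x C[h + h^*] itself carries a module over H_{t,c}: x and g act by
   left multiplication, and y acts by left multiplication by y plus a Dunkl operator
   t d_y - sum_s c_s alpha_s(y) D_s, where D_s is the skew derivation which divides
   the difference x - s x by alpha_s on h^* and only twists h by s.  The Dunkl
   operators commute: their commutator commutes with every x by the Jacobi identity,
   and it kills the elements without x, which generate.

   Let L_y denote left multiplication by y.  Replacing the action of y by
   L_y T + (Dunkl operator) still gives a representation, now by polynomials in T
   over the endomorphism ring, so an element of filtration degree n acts with degree
   at most n in T, and its coefficient of T^n depends only on its class in gr.  The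
   resulting ring morphism from gr to endomorphisms, composed with xi_t, is the left
   regular representation; hence xi_t is injective.  An element of the kernel of xi
   vanishes at hbar = t for all t by the same argument, and is therefore zero. *)
From HB Require Import structures.
Require Import Defs.
From mathcomp Require Import all_boot all_order all_fingroup all_algebra.
From mathcomp Require Import classical_sets boolp functions reals.
From mathcomp.multinomials Require Import monalg.
From mathcomp.real_closed Require Import complex.

Set Implicit Arguments.
Unset Strict Implicit.
Unset Printing Implicit Defensive.

Import GRing.Theory.
Local Open Scope ring_scope.
Local Open Scope classical_set_scope.

(** * Lifts to possibly trivial rings, smash products, linear endomorphisms *)

(** Write D_y for the Dunkl operator of y. That y and y' commute in the representation over T is a
    condition on each power of T. At T^2 it is commutativity of the symmetric algebra, at T^0
    commutativity of the Dunkl operators, and at T^1 it says that [D_y, L_y'] is symmetric in y and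
    y'. The T^1 condition explains how D_s acts on h: with D_s (y' a) = s(y') D_s(a), the commutator
    involves y' - s y', which is a multiple of alpha_s(y') alpha_s^vee, and this meets the factor
    alpha_s(y) already present. In the relation between y and x no T survives, because L_y commutes
    with multiplication by x.

    The partial derivatives and the D_s are instances of one notion, a skew derivation attached to a
    pair (g, b): either g = 1 with b arbitrary in h, or g = s with b = alpha_s^vee. Existence,
    uniqueness, linearity in b and behaviour under conjugation are then proved once for both. *)

Lemma trivial_target_rmorphism (R B : pzRingType) :
  1 = 0 :> B -> inhabited {rmorphism R -> B}.
Proof.
move=> B0; pose f (_ : R) : B := 0.
have fB : zmod_morphism f by move=> a b; rewrite /f subrr.
have fM : monoid_morphism f by split=> [|a b]; rewrite /f ?mulr0.
pose m := GRing.isMonoidMorphism.Build R B f fM.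
pose z := GRing.isZmodMorphism.Build R B f fB.
pose F : {rmorphism R -> B} := HB.pack f z m.
by exists.
Qed.

Lemma trivial_ring_eq (B : pzRingType) : 1 = 0 :> B -> forall a b : B, a = b.
Proof. by move=> B0 a b; rewrite -[a]mul1r -[b]mul1r B0 !mul0r. Qed.

Section TensorSymmetricInduction.
Variables (K : fieldType) (V : lmodType K).

Lemma tens_mul_ind (P : tens V -> Prop) :
    (forall a, P (tens_scal V a)) ->
    (forall a b, P a -> P b -> P (a + b)) ->
    (forall v a, P a -> P (tens_var v * a)) ->
  forall a, P a.
Proof.
move=> PC PD PM; elim/rquot_ind=> p; rewrite [p]monalgE (rmorph_sum (rquot_proj (@tens_rel K V))).
elim/big_ind: _ => //; first by rewrite -(rmorph0 (tens_scal V)); exact: PC.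
case=> s _; move: (p@_ _) => a; elim: s => [|v s ih].
  have -> : << a *g FMonom [::] >> = a%:MP :> {malg K[{fmonom V}]}.
    by rewrite -fmoneE.
  exact: PC.
have -> : << a *g FMonom (v :: s) >> = free_var v * << a *g FMonom s >>.
  rewrite malgM_def fgmulUU mul1r; congr << _ *g _ >>.
  by apply/eqP; rewrite fmP fmM fmuE.
by rewrite (rmorphM (rquot_proj (@tens_rel K V))); exact: PM.
Qed.

Lemma sym_mul_ind (P : sym V -> Prop) :
    (forall a, P (sym_scal V a)) ->
    (forall a b, P a -> P b -> P (a + b)) ->
    (forall v a, P a -> P (sym_var v * a)) ->
  forall a, P a.
Proof.
move=> PC PD PM; elim/rquot_ind; elim/tens_mul_ind => [a|a b Pa Pb|v a Pa].
- exact: PC.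
- by rewrite rmorphD; exact: PD.
- by rewrite (rmorphM (rquot_proj (@sym_rel K V))); exact: PM.
Qed.

Lemma sym_mulC : forall a b : sym V, a * b = b * a.
Proof.
have varC v : forall b : sym V, sym_var v * b = b * sym_var v.
  elim/sym_mul_ind => [a|a b va vb|w b vb].
  - by rewrite sym_scalC.
  - by rewrite mulrDr mulrDl va vb.
  - by rewrite mulrA sym_varC -!mulrA vb.
elim/sym_mul_ind => [a|a b va vb|w a wa] c.
- exact: sym_scalC.
- by rewrite mulrDl mulrDr va vb.
- by rewrite -mulrA wa mulrA varC mulrA.
Qed.

(** The target will be [gr] of a Cherednik algebra, where [1 != 0] is only a consequence of the
    theorem. If [1 = 0] in [B], all elements of [B] are equal and the required equations hold for
    any map. *)
Lemma sym_lift_pz (B : pzRingType) (sc : {rmorphism K -> B}) (phi : V -> B) :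
    (forall a b, GRing.comm (sc a) b) ->
    (forall a v w, phi (a *: v + w) = sc a * phi v + phi w) ->
    (forall v w, phi v * phi w = phi w * phi v) ->
  exists f : {rmorphism sym V -> B},
    (forall a, f (sym_scal V a) = sc a) /\ (forall v, f (sym_var v) = phi v).
Proof.
move=> scC phi_lin phiC; have [B0|B1] := pselect (1 = 0 :> B).
  have [f] := trivial_target_rmorphism (sym V) B0.
  by exists f; split=> *; exact: trivial_ring_eq.
have B_nz : 1 != 0 :> B by apply/eqP.
pose C : nzRingType := HB.pack (GRing.PzRing.sort B)
  (GRing.PzSemiRing_isNonZero.Build B B_nz).
exists (@sym_lift _ _ C sc phi scC phi_lin phiC); split=> [a|v].
- exact: (@sym_lift_scal _ _ C).
- exact: (@sym_lift_var _ _ C).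
Qed.

Lemma tens_lift_pz (B : pzRingType) (sc : {rmorphism K -> B}) (phi : V -> B) :
    (forall a b, GRing.comm (sc a) b) ->
    (forall a v w, phi (a *: v + w) = sc a * phi v + phi w) ->
  exists f : {rmorphism tens V -> B},
    (forall a, f (tens_scal V a) = sc a) /\ (forall v, f (tens_var v) = phi v).
Proof.
move=> scC phi_lin; have [B0|B1] := pselect (1 = 0 :> B).
  have [f] := trivial_target_rmorphism (tens V) B0.
  by exists f; split=> *; exact: trivial_ring_eq.
have B_nz : 1 != 0 :> B by apply/eqP.
pose C : nzRingType := HB.pack (GRing.PzRing.sort B)
  (GRing.PzSemiRing_isNonZero.Build B B_nz).
exists (@tens_lift _ _ C sc phi scC phi_lin); split=> [a|v].
- exact: (@tens_lift_scal _ _ C).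
- exact: (@tens_lift_var _ _ C).
Qed.

End TensorSymmetricInduction.

Lemma poly_lift_pz (R : nzRingType) (B : pzRingType) (f : {rmorphism R -> B})
    (z : B) : (forall a, z * f a = f a * z) ->
  exists F : {rmorphism {poly R} -> B}, (forall a, F a%:P = f a) /\ F 'X = z.
Proof.
move=> zC; have [B0|B1] := pselect (1 = 0 :> B).
  have [F] := trivial_target_rmorphism {poly R} B0.
  by exists F; split=> *; exact: trivial_ring_eq.
have B_nz : 1 != 0 :> B by apply/eqP.
pose C : nzRingType := HB.pack (GRing.PzRing.sort B)
  (GRing.PzSemiRing_isNonZero.Build B B_nz).
pose g : {rmorphism R -> C} := f.
have cz : commr_rmorph g (z : C) by move=> a; exact: zC.
exists (horner_morph cz : {rmorphism {poly R} -> C}); split=> [a|].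
- exact: (@horner_morphC R C g z cz a).
- exact: (@horner_morphX R C g z cz).
Qed.

(** * The smash product: multiplication rules and universal property *)

Section SmashMaps.
Variables (gT : finGroupType) (A : nzRingType) (act : ring_action gT A).

Local Notation emb := (smash_emb act).
Local Notation grp := (smash_grp act).

Lemma smash_mulE (f1 f2 : smash act) k :
  (f1 * f2) k = \sum_g f1 g * act g (f2 (g^-1 * k)%g).
Proof. by rewrite [_ * _]/(smash_mul f1 f2) ffunE. Qed.

Lemma smash_oneE : 1 = grp 1%g. Proof. by []. Qed.

Lemma smash_emb_mulE a (f : smash act) k : (emb a * f) k = a * f k.
Proof.
rewrite smash_mulE (bigD1 1%g) //= ffunE eqxx ract1 invg1 mul1g big1 ?addr0 //.
by move=> g /negbTE g1; rewrite ffunE g1 mul0r.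
Qed.

Lemma smash_grp_mulE g (f : smash act) k : (grp g * f) k = act g (f (g^-1 * k)%g).
Proof. exact: smash_mul_grp. Qed.

Lemma smash_emb_zmod_morphism : zmod_morphism emb.
Proof.
by move=> a b; apply/ffunP=> g; rewrite !ffunE; case: eqP => // _; rewrite subrr.
Qed.
Lemma smash_emb_monoid_morphism : monoid_morphism emb.
Proof.
split=> [|a b].
  by apply/ffunP=> g; rewrite smash_oneE !ffunE; case: eqP.
apply/ffunP=> g; rewrite smash_emb_mulE !ffunE.
by case: eqP => // _; rewrite mulr0.
Qed.
HB.instance Definition _ :=
  GRing.isZmodMorphism.Build A (smash act) emb smash_emb_zmod_morphism.
HB.instance Definition _ :=
  GRing.isMonoidMorphism.Build A (smash act) emb smash_emb_monoid_morphism.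

Lemma smash_grpM g k : grp (g * k)%g = grp g * grp k.
Proof.
apply/ffunP=> l; rewrite smash_grp_mulE !ffunE -(inj_eq (mulgI g^-1%g)) mulKg.
by rewrite rmorph_nat.
Qed.

Lemma smash_grp_emb g a : grp g * emb a = emb (act g a) * grp g.
Proof.
apply/ffunP=> k; rewrite smash_grp_mulE smash_emb_mulE !ffunE.
rewrite -(inj_eq (mulgI g)) mulKVg mulg1.
by case: eqP => _; rewrite ?rmorph0 ?mulr0 ?mulr1.
Qed.

Lemma smash_decomp (f : smash act) : f = \sum_g emb (f g) * grp g.
Proof.
apply/ffunP=> k; rewrite sum_ffunE (bigD1 k) //= smash_emb_mulE ffunE eqxx mulr1.
rewrite big1 ?addr0 // => g ngk.
by rewrite smash_emb_mulE ffunE eq_sym (negbTE ngk) mulr0.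
Qed.

Lemma smash_emb_comm a (f : smash act) :
    (forall g, act g a = a) -> (forall b, a * b = b * a) ->
  emb a * f = f * emb a.
Proof.
move=> fix_a aC; rewrite [f]smash_decomp mulr_sumr mulr_suml.
apply: eq_bigr => g _; rewrite -mulrA smash_grp_emb fix_a mulrA -rmorphM aC.
by rewrite rmorphM mulrA.
Qed.

Lemma smash_ext (B : pzRingType) (f1 f2 : {rmorphism smash act -> B}) :
    (forall a, f1 (emb a) = f2 (emb a)) -> (forall g, f1 (grp g) = f2 (grp g)) ->
  f1 =1 f2.
Proof.
move=> e1 e2 q; rewrite [q]smash_decomp !rmorph_sum; apply: eq_bigr => g _.
by rewrite !rmorphM e1 e2.
Qed.

(** The last hypothesis is the rule [g a = (act g a) g] transported to [B]. It makes the only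
    candidate, read off from the normal form [smash_decomp], multiplicative. *)
Lemma smash_lift (B : pzRingType) (f : {rmorphism A -> B}) (u : gT -> B) :
    u 1%g = 1 -> (forall g k, u (g * k)%g = u g * u k) ->
    (forall g a, u g * f a = f (act g a) * u g) ->
  exists F : {rmorphism smash act -> B},
    (forall a, F (emb a) = f a) /\ (forall g, F (grp g) = u g).
Proof.
move=> u1 uM ufC; pose F (q : smash act) := \sum_g f (q g) * u g.
have FB : zmod_morphism F.
  move=> p q; rewrite /F -sumrB; apply: eq_bigr => g _.
  by rewrite !ffunE rmorphB mulrBl.
have Femb a : F (emb a) = f a.
  rewrite /F (bigD1 1%g) //= ffunE eqxx u1 mulr1 big1 ?addr0 // => g /negbTE g1.
  by rewrite ffunE g1 rmorph0 mul0r.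
have Fgrp g : F (grp g) = u g.
  rewrite /F (bigD1 g) //= ffunE eqxx rmorph1 mul1r big1 ?addr0 // => k /negbTE kg.
  by rewrite ffunE kg rmorph0 mul0r.
have FM : monoid_morphism F.
  split=> [|p q]; first by rewrite smash_oneE Fgrp.
  rewrite {1}/F; under eq_bigr => k _ do rewrite smash_mulE rmorph_sum mulr_suml.
  rewrite exchange_big /= [F p]/F mulr_suml; apply: eq_bigr => g _.
  rewrite (reindex_inj (mulgI g)) /= [F q]/F mulr_sumr; apply: eq_bigr => k _.
  by rewrite mulKg rmorphM uM -!mulrA; congr (_ * _); rewrite !mulrA ufC.
pose m := GRing.isMonoidMorphism.Build _ _ F FM.
pose z := GRing.isZmodMorphism.Build _ _ F FB.
pose FF : {rmorphism smash act -> B} := HB.pack F z m.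
by exists FF.
Qed.

End SmashMaps.

(** * The ring of linear endomorphisms of a module *)

Section LinearEndomorphisms.
Variables (K : fieldType) (M : lmodType K).

Definition lin_pred : {pred M -> M} := fun f => `[< linear f >].

Lemma lin_zmod_closed : zmod_closed lin_pred.
Proof.
split; first by apply/asboolP=> a u v; rewrite scaler0 add0r.
move=> f g /asboolP lf /asboolP lg; apply/asboolP=> a u v.
rewrite [LHS]/(f (a *: u + v) - g (a *: u + v)) lf lg.
by rewrite [(f - g) u]/(f u - g u) [(f - g) v]/(f v - g v) scalerBr opprD addrACA.
Qed.
HB.instance Definition _ :=
  GRing.isZmodClosed.Build (M -> M) lin_pred lin_zmod_closed.

Record lend : Type := Lend { lend_fun :> M -> M; _ : lend_fun \in lin_pred }.
HB.instance Definition _ := [isSub for lend_fun].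
HB.instance Definition _ := [Choice of lend by <:].
HB.instance Definition _ := [SubChoice_isSubZmodule of lend by <:].

Lemma lendP (f g : lend) : f =1 g -> f = g.
Proof. by move=> fg; apply: val_inj; apply/funext. Qed.

Lemma lend_linear (f : lend) : linear f.
Proof. by apply/asboolP; exact: (valP f). Qed.
HB.instance Definition _ (f : lend) :=
  GRing.isLinear.Build K M M _ (lend_fun f) (lend_linear f).

Lemma lin_of_linear (f : M -> M) : linear f -> f \in lin_pred.
Proof. by move=> lf; apply/asboolP. Qed.

(* Locked, because unification is very slow at telling apart the operators of
   the smash product when it may unfold them. *)
Fact mk_lend_key : unit. Proof. by []. Qed.
Definition mk_lend (f : M -> M) (lf : linear f) : lend :=
  locked_with mk_lend_key (Lend (lin_of_linear lf)).

Lemma mk_lendE (f : M -> M) (lf : linear f) u : mk_lend lf u = f u.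
Proof. by rewrite /mk_lend unlock. Qed.

Lemma lend_mul_linear (f g : lend) : linear (f \o g).
Proof. by move=> a u v /=; rewrite !linearP. Qed.
Lemma lend_id_linear : linear (@id M). Proof. by []. Qed.

Definition lend_mul f g := mk_lend (lend_mul_linear f g).
Definition lend_one := mk_lend lend_id_linear.

Lemma lend_mulA : associative lend_mul.
Proof. by move=> f g h; apply: lendP => u; rewrite !mk_lendE /= !mk_lendE. Qed.
Lemma lend_mul1 : left_id lend_one lend_mul.
Proof. by move=> f; apply: lendP => u; rewrite mk_lendE /= mk_lendE. Qed.
Lemma lend_1mul : right_id lend_one lend_mul.
Proof. by move=> f; apply: lendP => u; rewrite mk_lendE /= mk_lendE. Qed.
Lemma lend_mulDl : left_distributive lend_mul +%R.
Proof.
move=> f g h; apply: lendP => u.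
by rewrite mk_lendE [RHS]/(lend_mul f h u + lend_mul g h u) !mk_lendE.
Qed.
Lemma lend_mulDr : right_distributive lend_mul +%R.
Proof.
move=> f g h; apply: lendP => u.
rewrite mk_lendE [RHS]/(lend_mul f g u + lend_mul f h u) !mk_lendE.
exact: raddfD.
Qed.
HB.instance Definition _ := GRing.Zmodule_isPzRing.Build lend
  lend_mulA lend_mul1 lend_1mul lend_mulDl lend_mulDr.

Lemma lend_mulE (f g : lend) u : (f * g) u = f (g u).
Proof. exact: mk_lendE. Qed.
Lemma lend_oneE u : (1 : lend) u = u. Proof. exact: mk_lendE. Qed.
Lemma lend_zeroE u : (0 : lend) u = 0. Proof. by []. Qed.
Lemma lend_addE (f g : lend) u : (f + g) u = f u + g u. Proof. by []. Qed.
Lemma lend_subE (f g : lend) u : (f - g) u = f u - g u. Proof. by []. Qed.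
Lemma lend_sumE (I : Type) (r : seq I) (P : pred I) (F : I -> lend) u :
  (\sum_(i <- r | P i) F i) u = \sum_(i <- r | P i) F i u.
Proof. by elim/big_rec2: _ => // i x y _ <-. Qed.

Lemma lend_scal_linear (a : K) : linear (fun u : M => a *: u).
Proof. by move=> b u v; rewrite scalerDr !scalerA mulrC. Qed.
Definition lend_scal (a : K) : lend := mk_lend (lend_scal_linear a).

Lemma lend_scalE a u : lend_scal a u = a *: u. Proof. exact: mk_lendE. Qed.
Lemma lend_scal_zmod_morphism : zmod_morphism lend_scal.
Proof. by move=> a b; apply: lendP => u; rewrite lend_subE !lend_scalE scalerBl. Qed.
Lemma lend_scal_monoid_morphism : monoid_morphism lend_scal.
Proof.
split=> [|a b]; apply: lendP => u; first by rewrite lend_scalE scale1r lend_oneE.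
by rewrite lend_mulE !lend_scalE scalerA.
Qed.
HB.instance Definition _ :=
  GRing.isZmodMorphism.Build K lend lend_scal lend_scal_zmod_morphism.
HB.instance Definition _ :=
  GRing.isMonoidMorphism.Build K lend lend_scal lend_scal_monoid_morphism.

Lemma lend_scalC a (f : lend) : GRing.comm (lend_scal a) f.
Proof. by apply: lendP => u; rewrite !lend_mulE !lend_scalE linearZ. Qed.

End LinearEndomorphisms.

(** * The associated graded ring and the symbol map *)

Section GradedClasses.
Variables (R : pzRingType) (F : filtration R).

Lemma reesP (a b : rees F) : (forall n, rees_val a n = rees_val b n) -> a = b.
Proof. by move=> ab; apply: val_inj; apply/funext. Qed.

Lemma rees_valB (a b : rees F) n : rees_val (a - b) n = rees_val a n - rees_val b n.
Proof. exact (congr1 (fun f : pseries R => f n) (raddfB (val : rees F -> pseries R) a b)). Qed.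

Lemma rees_valD (a b : rees F) n : rees_val (a + b) n = rees_val a n + rees_val b n.
Proof. exact (congr1 (fun f : pseries R => f n) (raddfD (val : rees F -> pseries R) a b)). Qed.

Lemma rees_valM (a b : rees F) n :
  rees_val (a * b) n = \sum_(i < n.+1) rees_val a i * rees_val b (n - i)%N.
Proof. exact (congr1 (fun f : pseries R => f n) (rmorphM (val : rees F -> pseries R) a b)). Qed.

Lemma rees_val1 n : rees_val (1 : rees F) n = (n == 0%N)%:R.
Proof. exact (congr1 (fun f : pseries R => f n) (rmorph1 (val : rees F -> pseries R))). Qed.

Lemma rees_val_fil (a : rees F) n : F n (rees_val a n).
Proof. by have /asboolP[] := valP a. Qed.

Lemma rees_val_bound (a : rees F) :
  exists N, forall n, (N <= n)%N -> rees_val a n = 0.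
Proof. by have /asboolP[] := valP a. Qed.

Lemma gr_class_eq n x y (Fx : F n x) (Fy : F n y) :
  x = y -> gr_class Fx = gr_class Fy.
Proof.
by move=> xy; congr (rquot_proj _ _); apply: reesP => m /=; rewrite xy.
Qed.

Lemma gr_classB n x y (Fx : F n x) (Fy : F n y) (Fxy : F n (x - y)) :
  gr_class Fxy = gr_class Fx - gr_class Fy.
Proof.
rewrite -(rmorphB (rquot_proj (@gr_rel R F))); congr (rquot_proj _ _).
apply: reesP => m; rewrite rees_valB /= /monomial.
by case: eqP => // _; rewrite subrr.
Qed.

Lemma gr_classD n x y (Fx : F n x) (Fy : F n y) (Fxy : F n (x + y)) :
  gr_class Fxy = gr_class Fx + gr_class Fy.
Proof.
rewrite -(rmorphD (rquot_proj (@gr_rel R F))); congr (rquot_proj _ _).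
apply: reesP => m; rewrite rees_valD /= /monomial.
by case: eqP => // _; rewrite addr0.
Qed.

Lemma gr_classM m n x y (Fx : F m x) (Fy : F n y) (Fxy : F (m + n) (x * y)) :
  gr_class Fxy = gr_class Fx * gr_class Fy.
Proof.
rewrite -(rmorphM (rquot_proj (@gr_rel R F))); congr (rquot_proj _ _).
apply: reesP => k; rewrite rees_valM /= /monomial.
have [->|kmn] := eqVneq k (m + n)%N.
  have mlt : (m < (m + n).+1)%N by rewrite ltnS leq_addr.
  rewrite (bigD1 (Ordinal mlt)) //= eqxx addKn eqxx big1 ?addr0 // => i.
  by rewrite -val_eqE /= => /negbTE ->; rewrite mul0r.
rewrite big1 // => i _; case: eqP => [im|]; last by rewrite mul0r.
case: eqP => [kn|]; last by rewrite mulr0.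
case/eqP: kmn; rewrite -im -kn subnKC //; exact: (ltn_ord i).
Qed.

Lemma gr_class_comm m n x y (Fx : F m x) (Fy : F n y) : x * y = y * x ->
  gr_class Fx * gr_class Fy = gr_class Fy * gr_class Fx.
Proof.
move=> xy; rewrite -(gr_classM Fx Fy (filM Fx Fy)).
(* The degrees [m + n] and [n + m] are equal but not convertible, so the membership proof is
   generalized before the index is rewritten. *)
have Fyx : F (m + n)%N (y * x) by rewrite addnC; exact: filM.
rewrite (gr_class_eq _ Fyx xy); move: Fyx; rewrite addnC => Fyx.
exact: gr_classM.
Qed.

Lemma gr_class1 (F1 : F 0 1) : gr_class F1 = 1.
Proof.
rewrite -(rmorph1 (rquot_proj (@gr_rel R F))); congr (rquot_proj _ _).
by apply: reesP => k; rewrite rees_val1 /= /monomial; case: eqP.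
Qed.

(** The relation [gr_rel] kills a component in positive degree that already lies one step lower.
    This is how the lower-order terms of the commutation relations disappear. *)
Lemma gr_class_weak m n x (Fx : F n x) : (m < n)%N -> F m x -> gr_class Fx = 0.
Proof.
case: n Fx => // n Fx mn Fmx.
rewrite -(rmorph0 (rquot_proj (@gr_rel R F))); apply/rquot_projP.
rewrite subr0; apply: tsi_rel; split=> // k /=; rewrite /monomial eqSS.
by case: eqP => [->|_]; [exact: (filW (m := m))|exact: fil0].
Qed.

Lemma gr_ind (P : gr F -> Prop) :
    P 0 -> (forall a b, P a -> P b -> P (a + b)) ->
    (forall n x (Fx : F n x), P (gr_class Fx)) ->
  forall q, P q.
Proof.
move=> P0 PD PC; elim/rquot_ind=> a; have [N aN] := rees_val_bound a.
(* A Rees element is the finite sum of its homogeneous components; cutting at the bound [N] loses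
   nothing. *)
pose part k : rees F := \sum_(n < k) Rees (monomial_rees (rees_val_fil a n)).
suff -> : a = part N.
  rewrite /part (rmorph_sum (rquot_proj (@gr_rel R F))).
  by apply: (big_ind P) => // i _; exact: PC.
have part_val k n : rees_val (part k) n = if (n < k)%N then rees_val a n else 0.
  rewrite /part; elim: k => [|k ih].
    rewrite big_ord0.
    exact (congr1 (fun f : pseries R => f n) (raddf0 (val : rees F -> pseries R))).
  rewrite big_ord_recr rees_valD ih /= /monomial ltnS (leq_eqVlt n k).
  by case: eqP => [->|_] /=; rewrite ?ltnn ?add0r ?addr0.
by apply: reesP => n; rewrite part_val; case: ltnP => // /aN.
Qed.

Lemma gr_class_central m x (Fx : F m x) : (forall y, x * y = y * x) ->
  forall q, gr_class Fx * q = q * gr_class Fx.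
Proof.
move=> xC; elim/gr_ind => [|a b xa xb|n y Fy].
- by rewrite mulr0 mul0r.
- by rewrite mulrDr mulrDl xa xb.
- exact: gr_class_comm.
Qed.

End GradedClasses.

Section SymbolMap.
Variables (R : pzRingType) (gen : nat -> R -> Prop).
Local Notation F := (gen_fil gen).

Lemma gr_surjective (P : pzRingType) (xi : {rmorphism P -> gr F}) :
    (forall n x (gx : gen n x), exists p, xi p = gr_class (F := F) (gen_fil_gen gx)) ->
  forall q, exists p, xi p = q.
Proof.
move=> xi_gen; elim/gr_ind => [|_ _ [p <-] [q <-]|n x Fx].
- by exists 0; rewrite rmorph0.
- by exists (p + q); rewrite rmorphD.
(* A class carries its membership proof. The induction runs on the derivation [Fx], while the class
   is taken for an arbitrary proof [Gx]. *)
suff h (Gx : gen_fil_pred gen n x) : exists p, xi p = gr_class (F := F) Gx by exact: h.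
elim: Fx Gx => {n x} [n x gx||n x y Fx ihx Fy ihy|m n x y Fx ihx Fy ihy|m n x mn Fx ih] Gx.
- by have [p xi_p] := xi_gen n x gx; exists p; rewrite xi_p; exact: gr_class_eq.
- by exists 1; rewrite rmorph1 gr_class1.
- have [[p xi_p] [q xi_q]] := (ihx Fx, ihy Fy).
  by exists (p - q); rewrite rmorphB xi_p xi_q -(@gr_classB R F _ _ _ _ _ Gx).
- have [[p xi_p] [q xi_q]] := (ihx Fx, ihy Fy).
  by exists (p * q); rewrite rmorphM xi_p xi_q -(@gr_classM R F _ _ _ _ _ _ Gx).
- move: mn; rewrite leq_eqVlt => /orP[/eqP mn|mn].
    by move: Gx; rewrite -mn => Gx; exact: ih.
  by exists 0; rewrite rmorph0 (@gr_class_weak R F m n x Gx mn).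
Qed.

Variables (E : nzRingType) (rho : {rmorphism R -> {poly E}}).
Hypothesis rho_gen : forall n x, gen n x -> (size (rho x) <= n.+1)%N.

Lemma size_rho n x : F n x -> (size (rho x) <= n.+1)%N.
Proof.
elim=> {n x} [n x /rho_gen //||n x y _ sx _ sy|m n x y _ sx _ sy|m n x mn _ sx].
- by rewrite rmorph1 size_poly1.
- by rewrite rmorphB (leq_trans (size_polyD _ _)) // size_polyN geq_max sx sy.
- rewrite rmorphM (leq_trans (size_polyMleq _ _)) //.
  by have := leq_add sx sy; rewrite addSn addnS; case: (size _ + size _)%N.
- by rewrite (leq_trans sx).
Qed.

(** A Rees element [a] is sent to the polynomial whose [n]-th coefficient is that of [rho (a n)]. By
    [size_rho] this is the highest coefficient that can be nonzero, so the map is multiplicative and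
    vanishes on components of smaller degree. Evaluation at 1 then adds up the graded pieces. *)
Lemma symbol_map : exists kappa : {rmorphism gr F -> E},
  forall n x (Fx : F n x), kappa (gr_class Fx) = (rho x)`_n.
Proof.
(* The bound serves only to have a polynomial; by [fE] its value does not affect the
   coefficients. *)
pose bound (a : rees F) := xget 0%N [set N | forall n, (N <= n)%N -> rees_val a n = 0].
pose f (a : rees F) : {poly E} := \poly_(n < bound a) (rho (rees_val a n))`_n.
have fE a n : (f a)`_n = (rho (rees_val a n))`_n.
  rewrite coef_poly; case: ltnP => // bn.
  suff -> : rees_val a n = 0 by rewrite rmorph0 coef0.
  have [N aN] := rees_val_bound a.
  have := @xgetPex _ 0%N [set N | forall n, (N <= n)%N -> rees_val a n = 0].
  by move=> /(_ (ex_intro _ N aN)); apply.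
have fB : zmod_morphism f.
  by move=> a b; apply/polyP=> n; rewrite coefB !fE rees_valB rmorphB coefB.
have fM : monoid_morphism f.
  split=> [|a b]; apply/polyP=> n.
    by rewrite fE rees_val1 rmorph_nat coef1; case: n => [|n]; rewrite ?coef1 ?coef0.
  rewrite coefM fE rees_valM rmorph_sum coef_sum; apply: eq_bigr => i _.
  have iK : (i + (n - i) = n)%N by rewrite subnKC // -ltnS.
  (* Only [j = i] contributes: for [j > i] the first factor is beyond the degree of [rho] of the
     [i]-th component of [a], for [j < i] the second is beyond that of the [(n - i)]-th component of
     [b]. *)
  rewrite !fE rmorphM coefM /= (bigD1 i) //= big1 ?addr0 // => j ji.
  have /size_rho si := rees_val_fil a i.
  have /size_rho sn := rees_val_fil b (n - i)%N.
  have [ij|] := ltnP i j; first by rewrite nth_default ?mul0r ?(leq_trans si).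
  rewrite leq_eqVlt val_eqE (negbTE ji) /= => {}ji.
  rewrite [X in _ * X]nth_default ?mulr0 // (leq_trans sn) //.
  by rewrite ltn_sub2l // (leq_trans ji) // -ltnS.
pose fm := GRing.isMonoidMorphism.Build _ _ f fM.
pose fz := GRing.isZmodMorphism.Build _ _ f fB.
pose ff : {rmorphism rees F -> {poly E}} := HB.pack f fz fm.
have c1 : commr_rmorph (@idfun E) 1 by move=> a; rewrite /GRing.comm mulr1 mul1r.
pose ev : {rmorphism {poly E} -> E} := horner_morph c1.
have f_rel a : gr_rel a -> (ev \o ff) a = 0.
  case=> a0 aS; suff fa0 : ff a = 0 by rewrite /comp fa0 rmorph0.
  apply/polyP=> n; rewrite coef0 [LHS]fE; case: n => [|n].
    by rewrite a0 rmorph0 coef0.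
  by rewrite nth_default // size_rho.
exists (rquot_lift f_rel) => n x Fx.
rewrite [LHS](rquot_liftE f_rel) /=.
have -> : f (Rees (monomial_rees Fx)) = (rho x)`_n *: 'X^n.
  apply/polyP=> m; rewrite fE coefZ coefXn /= /monomial.
  by case: eqP => [->|_]; rewrite ?mulr1 ?mulr0 ?rmorph0 ?coef0.
by rewrite /horner_morph map_poly_id // hornerZ hornerXn expr1n mulr1.
Qed.

End SymbolMap.

(** * Complex reflections *)

Section Reflections.
Variables (K : fieldType) (h : vectType K) (G : finGL h).
Variables (rts : reflection_roots G).
Hypothesis two_neq0 : 2 != 0 :> K.
Implicit Types (s g k : G) (x : dual h) (y : h).

Lemma gl_valK g : cancel (gl_val g) (gl_val g^-1%g).
Proof. by move=> y; rewrite -comp_lfunE -gl_valM mulVg gl_val1 id_lfunE. Qed.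

Lemma gl_valVK g : cancel (gl_val g^-1%g) (gl_val g).
Proof. by move=> y; rewrite -comp_lfunE -gl_valM mulgV gl_val1 id_lfunE. Qed.

Lemma gl_dualE g x y : gl_dual g x y = x (gl_val g^-1%g y).
Proof. by rewrite /gl_dual comp_lfunE. Qed.

Lemma coroot_neq0 s : s \in reflections G -> coroot rts s != 0.
Proof.
move=> sr; apply/eqP=> c0; have := root_coroot rts sr.
by rewrite c0 linear0 => /esym/eqP; rewrite (negbTE two_neq0).
Qed.

Lemma eigval_neq0 s : s \in reflections G -> eigval rts s != 0.
Proof.
move=> sr; apply/eqP=> l0; have := corootE rts sr; rewrite l0 invr0 scale0r => sc0.
by have := coroot_neq0 sr; rewrite -(gl_valK s (coroot rts s)) sc0 linear0 eqxx.
Qed.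

(** The numerator is the eigenvalue of [1 - s] on the coroot, and 2 is the value of the root there;
    the quotient is the scalar in [reflectionE]. *)
Definition refl_coef s : K := (1 - (eigval rts s)^-1) / 2.

Lemma refl_coef_neq0 s : s \in reflections G -> refl_coef s != 0.
Proof.
move=> sr; rewrite mulf_neq0 ?invr_eq0 // subr_eq0 eq_sym invr_eq1.
exact: eigval_neq1.
Qed.

Lemma root_gl_val s y : s \in reflections G ->
  Defs.root rts s (gl_val s y) = (eigval rts s)^-1 * Defs.root rts s y.
Proof.
move=> sr; have := Defs.rootE rts sr => /lfunP/(_ (gl_val s y)).
rewrite gl_dualE gl_valK scale_lfunE => ->.
by rewrite [_ *: _]/(_ * _) mulKf // eigval_neq0.
Qed.

(** The image of [1 - s] is a line containing the coroot, whose eigenvalue under [s] is not 1. So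
    the coroot spans it, and applying the root to both sides finds the coefficient. *)
Lemma reflectionE s y : s \in reflections G ->
  y - gl_val s y = (refl_coef s * Defs.root rts s y) *: coroot rts s.
Proof.
move=> sr; have := sr; rewrite inE => /asboolP[_ dim1].
have sub_lineP u : \1%VF u - gl_val s u \in limg (\1 - gl_val s)%VF.
  by rewrite -[_ - _](_ : (\1 - gl_val s)%VF u = _) ?memv_img ?memvf //
    add_lfunE opp_lfunE.
have coroot_img : coroot rts s \in limg (\1 - gl_val s)%VF.
  have := sub_lineP (coroot rts s); rewrite id_lfunE corootE //.
  rewrite -{1}[coroot rts s]scale1r -scalerBl => im.
  have l1 : 1 - (eigval rts s)^-1 != 0.
    by rewrite subr_eq0 eq_sym invr_eq1; exact: eigval_neq1.
  by have := memvZ (1 - (eigval rts s)^-1)^-1 im; rewrite scalerA mulVf // scale1r.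
have line : limg (\1 - gl_val s)%VF = <[coroot rts s]>%VS.
  apply/esym/eqP; rewrite eqEdim -memvE coroot_img /= dim1 dim_vline.
  by rewrite coroot_neq0.
have := sub_lineP y; rewrite line id_lfunE => /vlineP[a ya].
rewrite ya; congr (_ *: _).
have := congr1 (Defs.root rts s) ya.
rewrite linearB linearZ /= root_gl_val // root_coroot //.
rewrite -{1}[Defs.root rts s y]mul1r -mulrBl [_ *: _]/(_ * _) => e.
by rewrite /refl_coef mulrAC e mulfK.
Qed.

(** The dual action is through [s^-1], so this is [reflectionE] at [s^-1 y], whence the sign and the
    factor [eigval rts s]. The scalar in front of [x (coroot rts s)] is [(1 - eigval rts s) / 2]. *)
Lemma reflection_dualE s x : s \in reflections G ->
  x - gl_dual s x =
  (- (refl_coef s * eigval rts s) * x (coroot rts s)) *: Defs.root rts s.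
Proof.
move=> sr; apply/lfunP=> y; rewrite add_lfunE opp_lfunE scale_lfunE gl_dualE.
rewrite -{1}[y](gl_valVK s) -linearB.
set z := gl_val s^-1%g y.
have -> : gl_val s z - z = - (z - gl_val s z) by rewrite opprB.
rewrite reflectionE // linearN linearZ /=.
have -> : Defs.root rts s z = eigval rts s * Defs.root rts s y.
  by rewrite -(gl_valVK s y) root_gl_val // mulVKf // eigval_neq0.
have reg (m l a b : K) : - (m * (l * b) * a) = - (m * l) * a * b.
  by rewrite !mulNr -!mulrA [b * a]mulrC.
exact: reg.
Qed.

Lemma complex_reflection_conj s k :
  complex_reflection (gl_val s) -> complex_reflection (gl_val (k * s * k^-1)%g).
Proof.
have val_conj : gl_val (k * s * k^-1)%g =
    (gl_val k \o (gl_val s \o gl_val k^-1%g))%VF by rewrite !gl_valM comp_lfunA.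
have kK : (gl_val k \o gl_val k^-1%g)%VF = \1%VF by rewrite -gl_valM mulgV.
have kVK : (gl_val k^-1%g \o gl_val k)%VF = \1%VF by rewrite -gl_valM mulVg.
have ker0 g : lker (gl_val g) == 0%VS by exact: (gl_inj (ssvalP g)).
have img_kK (W : {vspace h}) : (gl_val k @: (gl_val k^-1%g @: W))%VS = W.
  by rewrite -limg_comp kK lim1g.
have img_kVK (W : {vspace h}) : (gl_val k^-1%g @: (gl_val k @: W))%VS = W.
  by rewrite -limg_comp kVK lim1g.
have img_full : (gl_val k @: fullv)%VS = fullv.
  apply/eqP; rewrite eqEsubv subvf /= -{1}(img_kK fullv).
  by rewrite limgS // subvf.
have img_fullV : (gl_val k^-1%g @: fullv)%VS = fullv.
  by rewrite -{1}img_full img_kVK.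
case=> ss dim1; split.
  move=> U; rewrite val_conj !limg_comp => sU.
  have := ss (gl_val k^-1%g @: U)%VS; case.
    by rewrite -[X in (X <= _)%VS]img_kVK limgS.
  move=> W [sW UW_full UW0]; exists (gl_val k @: W)%VS; split.
  - by rewrite !limg_comp img_kVK limgS.
  - by rewrite -[X in (X + _)%VS]img_kK -limgD UW_full.
  - by rewrite -[X in (X :&: _)%VS]img_kK -lker0_img_cap // UW0 limg0.
have -> : (\1 - gl_val (k * s * k^-1)%g)%VF =
    (gl_val k \o ((\1 - gl_val s) \o gl_val k^-1%g))%VF.
  rewrite val_conj; apply/lfunP=> y.
  rewrite !(comp_lfunE, add_lfunE, opp_lfunE, id_lfunE) linearB /=.
  by rewrite gl_valVK.
rewrite !limg_comp img_fullV limg_dim_eq //.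
by apply/eqP; rewrite -subv0 -(eqP (ker0 k)) capvSr.
Qed.

Lemma reflections_conj s k :
  ((k * s * k^-1)%g \in reflections G) = (s \in reflections G).
Proof.
rewrite !inE; apply: asbool_equiv_eq; split; last exact: complex_reflection_conj.
move/(complex_reflection_conj k^-1%g).
by rewrite invgK -!mulgA mulVg mulg1 mulKg.
Qed.

(** Roots and coroots are chosen separately for each reflection, so conjugation need not permute
    them. Their product is a multiple of [1 - s], hence determined by [s] and equivariant once the
    eigenvalues of [s] and of its conjugate are known to agree. *)
Lemma root_coroot_conj s k y : s \in reflections G ->
  (Defs.root rts (k * s * k^-1)%g (gl_val k y)) *: coroot rts (k * s * k^-1)%g =
  Defs.root rts s y *: gl_val k (coroot rts s).
Proof.
move=> sr; set s' := (k * s * k^-1)%g.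
have s'r : s' \in reflections G by rewrite reflections_conj.
have s'k z : gl_val s' (gl_val k z) = gl_val k (gl_val s z).
  by rewrite !gl_valM !comp_lfunE gl_valK.
have mu' z : (refl_coef s' * Defs.root rts s' (gl_val k z)) *: coroot rts s' =
    (refl_coef s * Defs.root rts s z) *: gl_val k (coroot rts s).
  by rewrite -reflectionE // s'k -linearB reflectionE // linearZ.
suff mu_eq : refl_coef s' = refl_coef s.
  have := mu' y; rewrite mu_eq -scalerA -[RHS]scalerA.
  by move/(scalerI (refl_coef_neq0 sr)).
(* The scalar comes from [mu'] at the coroot of [s], where the root of [s] takes the value 2. The
   translated coroot is thus an eigenvector of [s'] in two ways, and comparing its eigenvalues
   yields [mu_eq]. *)
have [r kr] : exists r, gl_val k (coroot rts s) = r *: coroot rts s'.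
  exists ((refl_coef s * 2)^-1 * (refl_coef s' * Defs.root rts s' (gl_val k (coroot rts s)))).
  rewrite -scalerA mu' root_coroot // scalerA mulVf ?scale1r //.
  by rewrite mulf_neq0 ?refl_coef_neq0.
have kc0 : gl_val k (coroot rts s) != 0.
  apply: contraNneq (coroot_neq0 sr) => kc0.
  by rewrite -(gl_valK k (coroot rts s)) kc0 linear0.
have : gl_val s' (gl_val k (coroot rts s)) =
    (eigval rts s')^-1 *: gl_val k (coroot rts s).
  have linZ a u : gl_val s' (a *: u) = a *: gl_val s' u by exact: linearZ.
  by rewrite kr linZ corootE // !scalerA mulrC.
rewrite s'k corootE // linearZ.
move/eqP; rewrite -subr_eq0 -scalerBl scaler_eq0 (negbTE kc0) orbF subr_eq0.
by move=> /eqP e; rewrite /refl_coef e.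
Qed.

End Reflections.

(** * Skew derivations *)

(* What the construction of the Dunkl operators uses of the symmetric algebra of
   h (+) h^*. Rewriting over an abstract algebra A keeps the quotient defining
   sym from being unfolded by unification. *)
Record sym_model (K : fieldType) (h : vectType K) (G : finGL h)
    (A : comAlgType K) := SymModel {
  mvar :> (h * dual h)%type -> A;
  mvar_linear : linear mvar;
  mvar_ind : forall P : A -> Prop,
    (forall a, P a%:A) -> (forall u v, P u -> P v -> P (u + v)) ->
    (forall v u, P u -> P (mvar v * u)) -> forall u, P u;
  mvar_lift : forall phi : (h * dual h)%type -> lend (A * A)%type,
    (forall a v w, phi (a *: v + w) = lend_scal _ a * phi v + phi w) ->
    (forall v w, phi v * phi w = phi w * phi v) ->
    exists f : {rmorphism A -> lend (A * A)%type},
      (forall a, f a%:A = lend_scal _ a) /\ (forall v, f (mvar v) = phi v);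
  sact : ring_action G A;
  sact_alg : forall g a, sact g a%:A = a%:A;
  sact_var : forall g v, sact g (mvar v) = mvar (gl_sum g v) }.

HB.instance Definition _ (K : fieldType) (h : vectType K) (G : finGL h)
    (A : comAlgType K) (m : sym_model G A) :=
  GRing.isLinear.Build K (h * dual h)%type A _ (mvar m) (mvar_linear m).

Section SkewDerivations.
Variables (K : fieldType) (h : vectType K) (G : finGL h).
Variables (A : comAlgType K) (m : sym_model G A).
Local Notation D := (dual h).
Local Notation V := (h * dual h)%type.
Implicit Types (g k : G) (b y : h) (v w : V).

Definition gl_left g v : V := (gl_val g v.1, v.2).

Lemma sactZ g c (a : A) : sact m g (c *: a) = c *: sact m g a.
Proof. by rewrite -mulr_algl rmorphM sact_alg mulr_algl. Qed.

(** For [g = 1] this is the partial derivative along [b], with the elements of [h] as constants. For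
    a reflection [s] and its coroot it is, on polynomials in the dual of [h], the divided difference
    [(1 - s) / alpha_s] times [2 / (1 - eigval s)]. *)
Definition is_skew g b (d : A -> A) : Prop :=
  [/\ linear d, d 1 = 0 &
   forall v a, d (m v * a) =
     m (gl_left g v) * d a + (v.2 b : K) *: sact m g a].

(* The condition under which the rule defining is_skew is compatible with the
   commutation of two elements of V. *)
Definition skew_compat g b : Prop := forall x x' : D,
  (x' b : K) *: (x - gl_dual g x) = (x b : K) *: (x' - gl_dual g x').

(** A skew derivation is the off-diagonal entry of a ring morphism into triangular 2 x 2 matrices:
    the operator attached to [a] sends [(0, 1)] to [(d a, sact m g a)]. By the universal property it
    suffices that the operators [op v] commute, and this is where [skew_compat] enters. *)
Lemma skew_exists g b : skew_compat g b -> exists d, is_skew g b d.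
Proof.
move=> gb.
pose op v (p : A * A) : A * A :=
  (m (gl_left g v) * p.1 + (v.2 b : K) *: p.2, m (gl_sum g v) * p.2).
have op_lin v : linear (op v).
  move=> a p q; rewrite /op -[(a *: p + q).1]/(a *: p.1 + q.1).
  rewrite -[(a *: p + q).2]/(a *: p.2 + q.2); congr (_, _) => /=.
    by rewrite mulrDr !scalerDr -scalerAr addrACA !scalerA [_ * a]mulrC.
  by rewrite mulrDr -scalerAr.
have pair_scale (c : K) (u v : A) : c *: (u, v) = (c *: u, c *: v) by [].
have op_linV a v w : mk_lend (op_lin (a *: v + w)) =
    lend_scal (A * A)%type a * mk_lend (op_lin v) + mk_lend (op_lin w).
  apply: lendP => p; rewrite lend_addE lend_mulE lend_scalE !mk_lendE /op.
  have -> : gl_left g (a *: v + w) = a *: gl_left g v + gl_left g w.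
    by rewrite /gl_left /= linearP.
  rewrite gl_sum_lin !linearP add_lfunE scale_lfunE pair_scale; congr (_, _).
    rewrite /= mulrDl scalerDl scalerDr addrACA -scalerAl.
    by rewrite [a *: (_ *: p.2)]scalerA.
  by rewrite /= mulrDl -scalerAl.
have opC v w : mk_lend (op_lin v) * mk_lend (op_lin w) =
    mk_lend (op_lin w) * mk_lend (op_lin v).
  apply: lendP => p; rewrite !lend_mulE !mk_lendE /op /=; congr (_, _); last first.
    by rewrite mulrCA.
  rewrite !mulrDr [m (gl_left g v) * (m _ * _)]mulrCA -!addrA; congr (_ + _).
  rewrite -!scalerAr !scalerAl -!mulrDl; congr (_ * _).
  rewrite -!linearZ -!linearD; congr (mvar m _).
  rewrite /gl_left /gl_sum; congr (_, _) => /=.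
    by rewrite addrC.
  apply/esym/eqP; have /eqP := gb v.2 w.2; rewrite !scalerBr subr_eq addrAC.
  by rewrite eq_sym subr_eq.
have [f [f_alg f_var]] := mvar_lift m op_linV opC.
have f2 a : (f a (0, 1)).2 = sact m g a.
  elim/(@mvar_ind _ _ _ _ m): a => [a|a a' fa fa'|v a fa].
  - by rewrite f_alg lend_scalE sact_alg.
  - by rewrite !rmorphD -fa -fa'.
  - by rewrite !rmorphM f_var sact_var -fa lend_mulE mk_lendE.
have f_scal c a : f (c *: a) = lend_scal _ c * f a by rewrite -mulr_algl rmorphM f_alg.
exists (fun a => (f a (0, 1)).1); split.
- by move=> c a a'; rewrite rmorphD f_scal lend_addE lend_mulE lend_scalE.
- by rewrite rmorph1 lend_oneE.
- by move=> v a; rewrite rmorphM f_var lend_mulE mk_lendE /= f2.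
Qed.

Lemma skew_unique g b d d' : is_skew g b d -> is_skew g b d' -> d =1 d'.
Proof.
case=> dlin d1 dM [d'lin d'1 d'M].
have alg0 (f : A -> A) c : linear f -> f 1 = 0 -> f c%:A = 0.
  move=> lf f1; have f0 : f 0 = 0.
    by have := lf (-1) 0 0; rewrite scaler0 addr0 scaleN1r addNr.
  by have := lf c 1 0; rewrite f1 f0 !addr0 scaler0.
elim/(@mvar_ind _ _ _ _ m) => [c|a a' da da'|v a da].
- by rewrite !alg0.
- by rewrite -[a]scale1r dlin d'lin da da'.
- by rewrite dM d'M da.
Qed.

(** The default 0 only covers pairs that admit no such operator; under [skew_compat] one exists and
    [skew_unique] makes the choice immaterial. *)
Definition skew_der g b : lend A := xget 0 [set d : lend A | is_skew g b d].

Lemma skew_derP g b : skew_compat g b -> is_skew g b (skew_der g b).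
Proof.
move=> /skew_exists [d ds]; have [dlin _ _] := ds.
have dE : mk_lend dlin = d :> (A -> A) by apply/funext=> u; exact: mk_lendE.
have ds' : is_skew g b (mk_lend dlin) by rewrite dE.
have ex : exists d' : lend A, [set d : lend A | is_skew g b d] d' by exists (mk_lend dlin).
exact: (xgetPex 0 ex).
Qed.

Lemma skew_compatZD g c b b' :
  skew_compat g b -> skew_compat g b' -> skew_compat g (c *: b + b').
Proof.
move=> gb gb' x x'; rewrite !linearP !scalerDl gb'; congr (_ + _).
by rewrite -[in LHS]scalerA -[in RHS]scalerA gb.
Qed.

Lemma skew_linear g c b b' a : skew_compat g b -> skew_compat g b' ->
  skew_der g (c *: b + b') a = c *: skew_der g b a + skew_der g b' a.
Proof.
move=> gb gb'; have gbb' := skew_compatZD c gb gb'.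
have [[l1 d1 dM] [l2 d2 d'M]] := (skew_derP gb, skew_derP gb').
apply: (skew_unique (d' := fun a => c *: skew_der g b a + skew_der g b' a)).
  exact: skew_derP.
split.
- move=> r u v; rewrite l1 l2 !scalerDr !scalerA mulrC -!scalerA.
  by rewrite addrACA.
- by rewrite d1 d2 scaler0 addr0.
- move=> v u; rewrite dM d'M linearP scalerDl scalerDr mulrDr addrACA.
  by rewrite -scalerAr -[in RHS]scalerA.
Qed.

Lemma skew_compat_conj g b k :
  skew_compat g b -> skew_compat (k * g * k^-1)%g (gl_val k b).
Proof.
have dualK x : gl_dual k (gl_dual k^-1%g x) = x.
  by apply/lfunP=> u; rewrite !gl_dualE invgK gl_valVK.
move=> gb x x'; have := gb (gl_dual k^-1%g x) (gl_dual k^-1%g x').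
move=> /(congr1 (gl_dual k)).
have dualB (u : K) z z' : gl_dual k (u *: (z - z')) =
    u *: (gl_dual k z - gl_dual k z').
  by apply/lfunP=> t; rewrite !(gl_dualE, scale_lfunE, add_lfunE, opp_lfunE).
rewrite !dualB !dualK !gl_dualE !invgK.
have conjE z : gl_dual k (gl_dual g (gl_dual k^-1%g z)) = gl_dual (k * g * k^-1)%g z.
  by apply/lfunP=> t; rewrite !gl_dualE -!comp_lfunE -!gl_valM !invMg !invgK mulgA.
by rewrite !conjE.
Qed.

Lemma skew_conj g b k a : skew_compat g b ->
  sact m k (skew_der g b a) = skew_der (k * g * k^-1)%g (gl_val k b) (sact m k a).
Proof.
move=> gb; have kgb := skew_compat_conj k gb.
have actK (u : A) : sact m k (sact m k^-1%g u) = u.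
  by rewrite -[LHS](ractM (sact m) k k^-1%g) mulgV ract1.
have actVK (u : A) : sact m k^-1%g (sact m k u) = u.
  by rewrite -[LHS](ractM (sact m) k^-1%g k) mulVg ract1.
(* The left side becomes the conjugate by [k] of the derivation, evaluated at [sact m k a]. This
   conjugate obeys the rule for the conjugated pair, so uniqueness applies. *)
rewrite -{1}[a]actVK.
have [l d1 dM] := skew_derP gb.
apply: (skew_unique (d := fun u => sact m k (skew_der g b (sact m k^-1%g u))))
  (skew_derP kgb) _; split.
- by move=> c u v; rewrite !(rmorphD, sactZ) l !(rmorphD, sactZ).
- by rewrite rmorph1 d1 rmorph0.
- move=> v u; rewrite rmorphM sact_var dM.
  rewrite rmorphD sactZ rmorphM sact_var.
  congr (_ * _ + _ *: _).
  + congr (mvar m _); congr (_, _).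
      rewrite -[LHS]/(gl_val k (gl_val g (gl_val k^-1%g v.1))).
      by rewrite -[RHS]/(gl_val (k * g * k^-1)%g v.1) !gl_valM !comp_lfunE.
    by apply/lfunP=> t; rewrite !gl_dualE invgK gl_valVK.
  + by rewrite /= gl_dualE invgK.
  + by rewrite [RHS]ractM /= ractM.
Qed.

Lemma skew_compat1 b : skew_compat 1%g b.
Proof.
have dual1 (x : D) : gl_dual (1%g : G) x = x.
  by apply/lfunP=> t; rewrite gl_dualE invg1 gl_val1 id_lfunE.
by move=> x x'; rewrite !dual1 !subrr !scaler0.
Qed.

(** Each element is a sum of products with all factors [x] outermost, applied to elements without
    [x], for which [N] stands. This is the shape needed for operators that commute with every
    [x]. *)
Lemma sym_normal_ind (N P : A -> Prop) :
    (forall c, N c%:A) ->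
    (forall y u, N u -> N (m ((y, 0) : V) * u)) ->
    (forall u, N u -> P u) -> (forall u u', P u -> P u' -> P (u + u')) ->
    (forall x u, P u -> P (m ((0, x) : V) * u)) ->
  forall u, P u.
Proof.
move=> N1 Ny.
pose closed (P : A -> Prop) := [/\ forall u, N u -> P u,
  forall u u', P u -> P u' -> P (u + u') &
  forall x u, P u -> P (m ((0, x) : V) * u)].
(* The least predicate with these closure properties. Its minimality, used for [S (m (y, 0) * u)] in
   [Sy], moves a factor [y] inward past all factors [x]. *)
pose S u := forall P, closed P -> P u.
suff S_all u : S u by move=> NP PD Px u; exact: S_all.
have SN a : N a -> S a by move=> Na P' [NP _ _]; exact: NP.
have SD a a' : S a -> S a' -> S (a + a').
  by move=> Sa Sa' P' P'P; have [_ PD _] := P'P; apply: PD; [exact: Sa|exact: Sa'].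
have Sx x a : S a -> S (m ((0, x) : V) * a).
  by move=> Sa P' P'P; have [_ _ Px] := P'P; apply: Px; exact: Sa.
have Sy y a : S a -> S (m ((y, 0) : V) * a).
  move=> Sa; apply: (Sa (fun u => S (m (y, 0) * u))); split=> [b Nb|b b' Sb Sb'|x b Sb].
  - by apply: SN; exact: Ny.
  - by rewrite mulrDr; exact: SD.
  - by rewrite mulrCA; exact: Sx.
elim/(@mvar_ind _ _ _ _ m): u => [c|a a' Sa Sa'|[y x] a Sa].
- exact: SN.
- exact: SD.
- have -> : (y, x) = ((y, 0) : V) + (0, x) by congr (_, _); rewrite /= ?addr0 ?add0r.
  by rewrite linearD mulrDl; apply: SD; [exact: Sy|exact: Sx].
Qed.

End SkewDerivations.

(** * Dunkl operators *)

Section SmashModule.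
Variables (K : fieldType) (h : vectType K) (G : finGL h).
Variables (A : comAlgType K) (m : sym_model G A).
Local Notation Q := (smash (sact m)).
Local Notation V := (h * dual h)%type.
Implicit Types (q : Q) (a : K).

Definition smash_scale a q : Q := [ffun g => a *: q g].

Lemma smash_scaleA a b q : smash_scale a (smash_scale b q) = smash_scale (a * b) q.
Proof. by apply/ffunP=> g; rewrite !ffunE scalerA. Qed.
Lemma smash_scale1 : left_id 1 smash_scale.
Proof. by move=> q; apply/ffunP=> g; rewrite !ffunE scale1r. Qed.
Lemma smash_scaleDr : right_distributive smash_scale +%R.
Proof. by move=> a p q; apply/ffunP=> g; rewrite !ffunE scalerDr. Qed.
Lemma smash_scaleDl q : {morph smash_scale^~ q : a b / a + b}.
Proof. by move=> a b; apply/ffunP=> g; rewrite !ffunE scalerDl. Qed.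
HB.instance Definition _ := GRing.Zmodule_isLmodule.Build K Q
  smash_scaleA smash_scale1 smash_scaleDr smash_scaleDl.

Lemma smash_scaleE a q g : (a *: q) g = a *: q g.
Proof. by rewrite [a *: q]/(smash_scale a q) ffunE. Qed.

Lemma smash_alg_mul a q : smash_emb (sact m) a%:A * q = a *: q.
Proof. by apply/ffunP=> g; rewrite smash_emb_mulE smash_scaleE mulr_algl. Qed.

Lemma smash_alg_comm a q : smash_emb (sact m) a%:A * q = q * smash_emb (sact m) a%:A.
Proof.
by apply: smash_emb_comm => [g|b]; [exact: sact_alg|rewrite mulr_algl mulr_algr].
Qed.

Lemma lmul_linear q : linear (fun p => q * p).
Proof. by move=> a p p'; rewrite mulrDr -!smash_alg_mul !mulrA smash_alg_comm. Qed.
Definition lmul q : lend Q := mk_lend (lmul_linear q).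

Lemma lmulE q p : lmul q p = q * p. Proof. exact: mk_lendE. Qed.
Lemma lmul_zmod_morphism : zmod_morphism lmul.
Proof. by move=> p q; apply: lendP => r; rewrite lend_subE !lmulE mulrBl. Qed.
Lemma lmul_monoid_morphism : monoid_morphism lmul.
Proof.
split=> [|p q]; apply: lendP => r; first by rewrite lmulE mul1r lend_oneE.
by rewrite lend_mulE !lmulE mulrA.
Qed.
HB.instance Definition _ :=
  GRing.isZmodMorphism.Build Q (lend Q) lmul lmul_zmod_morphism.
HB.instance Definition _ :=
  GRing.isMonoidMorphism.Build Q (lend Q) lmul lmul_monoid_morphism.

Lemma lmul_inj : injective lmul.
Proof. by move=> p q /(congr1 (fun f : lend Q => f 1)); rewrite !lmulE !mulr1. Qed.

Lemma lend_smash_neq0 : 1 != 0 :> lend Q.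
Proof.
apply/eqP => /(congr1 (fun f : lend Q => f 1)).
by rewrite lend_oneE lend_zeroE => /eqP; rewrite oner_eq0.
Qed.
HB.instance Definition _ := GRing.PzSemiRing_isNonZero.Build (lend Q) lend_smash_neq0.

Lemma lmul_alg a : lmul (smash_emb (sact m) a%:A) = lend_scal Q a.
Proof. by apply: lendP => q; rewrite lmulE smash_alg_mul lend_scalE. Qed.

End SmashModule.

(* Sealed: deciding that two of these operators differ by computing with finite
   functions on G does not terminate in practice. *)
HB.lock Definition op_var (K : fieldType) (h : vectType K) (G : finGL h)
    (A : comAlgType K) (m : sym_model G A) (v : h * dual h) : lend (smash (sact m)) :=
  lmul (smash_emb (sact m) (m v)).

HB.lock Definition op_grp (K : fieldType) (h : vectType K) (G : finGL h)
    (A : comAlgType K) (m : sym_model G A) (g : G) : lend (smash (sact m)) :=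
  lmul (smash_grp (sact m) g).

Lemma op_skew_linear (K : fieldType) (h : vectType K) (G : finGL h)
    (A : comAlgType K) (m : sym_model G A) (d : lend A) (g : G) :
  linear (fun q : smash (sact m) => [ffun k => d (q (g^-1 * k)%g)] : smash (sact m)).
Proof.
move=> a p q; apply/ffunP=> k.
by rewrite [RHS]ffunE smash_scaleE !ffunE linearP.
Qed.

(** On [a k], with [a] in [A] and [k] in the group, the value is [d(a) g k] for [d] the skew
    derivation of the pair. The extra [g] is the group element that appears in the defining relation
    between [y] and [x]. *)
HB.lock Definition op_skew (K : fieldType) (h : vectType K) (G : finGL h)
    (A : comAlgType K) (m : sym_model G A) (g : G) (b : h) : lend (smash (sact m)) :=
  mk_lend (op_skew_linear (skew_der m g b) g).

(** * Commutation rules of the operators on the smash product *)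

Section Operators.
Variables (K : fieldType) (h : vectType K) (G : finGL h).
Variables (A : comAlgType K) (m : sym_model G A).
Local Notation Q := (smash (sact m)).
Local Notation V := (h * dual h)%type.
Local Notation op_var := (op_var m).
Local Notation op_grp := (op_grp m).
Local Notation op_skew := (op_skew m).
Implicit Types (q : Q) (a : K) (g k : G) (v w : V) (b : h).

Lemma op_varE v q k : op_var v q k = m v * q k.
Proof. by rewrite op_var.unlock lmulE smash_emb_mulE. Qed.

Lemma op_grpE g q k : op_grp g q k = sact m g (q (g^-1 * k)%g).
Proof. by rewrite op_grp.unlock lmulE smash_grp_mulE. Qed.

Lemma op_var_lin a v w :
  op_var (a *: v + w) = lend_scal Q a * op_var v + op_var w.
Proof.
apply: lendP => q; apply/ffunP=> k.
rewrite lend_addE lend_mulE lend_scalE op_varE [RHS]ffunE smash_scaleE !op_varE.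
by rewrite linearP mulrDl scalerAl.
Qed.

Lemma op_varC v w : op_var v * op_var w = op_var w * op_var v.
Proof.
by apply: lendP => q; apply/ffunP=> k; rewrite !lend_mulE !op_varE mulrCA.
Qed.

Lemma op_grpM g k : op_grp (g * k)%g = op_grp g * op_grp k.
Proof. by rewrite op_grp.unlock smash_grpM rmorphM. Qed.

Lemma op_grp1 : op_grp 1%g = 1.
Proof. by rewrite op_grp.unlock; exact: rmorph1. Qed.

Lemma op_grp_var g v : op_grp g * op_var v = op_var (gl_sum g v) * op_grp g.
Proof.
apply: lendP => q; apply/ffunP=> k; rewrite !lend_mulE op_varE !op_grpE op_varE.
by rewrite rmorphM sact_var.
Qed.

Lemma op_skewE g b q k : op_skew g b q k = skew_der m g b (q (g^-1 * k)%g).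
Proof. by rewrite op_skew.unlock mk_lendE ffunE. Qed.

Lemma op_skew_var g b v : skew_compat g b ->
  op_skew g b * op_var v =
  op_var (gl_left g v) * op_skew g b + lend_scal Q (v.2 b) * op_grp g.
Proof.
move=> /(skew_derP m)[_ _ dM]; apply: lendP => q; apply/ffunP=> k.
rewrite lend_addE !lend_mulE lend_scalE [RHS]ffunE smash_scaleE.
by rewrite op_skewE !op_varE op_skewE op_grpE dM.
Qed.

Lemma op_skew_y g b (y : h) : skew_compat g b ->
  op_skew g b * op_var ((y, 0) : V) = op_var ((gl_val g y, 0) : V) * op_skew g b.
Proof.
move=> gb; rewrite op_skew_var //= lfunE /= -[X in lend_scal _ X]/(0 : K).
by rewrite rmorph0 mul0r addr0.
Qed.

Lemma op_skew_grp g b k : skew_compat g b ->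
  op_grp k * op_skew g b = op_skew (k * g * k^-1)%g (gl_val k b) * op_grp k.
Proof.
move=> gb; apply: lendP => q; apply/ffunP=> j.
rewrite !lend_mulE op_skewE !op_grpE op_skewE skew_conj //.
by rewrite !invMg invgK !mulgA mulVg mul1g.
Qed.

Lemma op_skew_lin g a b b' : skew_compat g b -> skew_compat g b' ->
  op_skew g (a *: b + b') = lend_scal Q a * op_skew g b + op_skew g b'.
Proof.
move=> gb gb'; apply: lendP => q; apply/ffunP=> k.
rewrite lend_addE lend_mulE lend_scalE [RHS]ffunE smash_scaleE.
by rewrite !op_skewE skew_linear.
Qed.

Lemma op_skewZ g a b : skew_compat g b ->
  op_skew g (a *: b) = lend_scal Q a * op_skew g b.
Proof.
have gb0 : skew_compat g 0 by move=> x x'; rewrite !linear0 !scale0r.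
move=> gb; have := op_skew_lin 1 gb0 gb0; rewrite scaler0 addr0 rmorph1 mul1r.
move=> e0; have op0 : op_skew g 0 = 0.
  by apply: (addrI (op_skew g 0)); rewrite addr0.
by rewrite -[a *: b]addr0 op_skew_lin // op0 addr0.
Qed.

End Operators.

(** * The Dunkl operators and their commutativity *)

Section DunklOperators.
Variables (K : fieldType) (h : vectType K) (G : finGL h).
Variables (rts : reflection_roots G) (c : G -> K) (t : K).
Hypothesis two_neq0 : 2 != 0 :> K.
Hypothesis c_inv : forall s g : G,
  s \in reflections G -> c (g * s * g^-1)%g = c s.
Variables (A : comAlgType K) (m : sym_model G A).
Local Notation Q := (smash (sact m)).
Local Notation V := (h * dual h)%type.
Local Notation sc := (lend_scal Q).
Local Notation op_var := (op_var m).
Local Notation op_grp := (op_grp m).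
Local Notation op_skew := (op_skew m).
Implicit Types (s g k : G) (x : dual h) (y : h).

Lemma skew_compat_refl s : s \in reflections G -> skew_compat s (coroot rts s).
Proof.
move=> sr x x'; rewrite !(reflection_dualE rts two_neq0) //.
by rewrite !scalerA ![_ * (- _ * _)]mulrCA [x' _ * x _]mulrC.
Qed.

(** On polynomials in the dual of [h] these are the classical Dunkl operators; their usual factor
    [2 / (1 - eigval s)] is contained in [skew_der]. *)
Definition dunkl y : lend Q := locked (sc t * op_skew 1%g y -
  \sum_(s in reflections G)
    sc (c s * Defs.root rts s y) * op_skew s (coroot rts s)).

Definition op_comm y x : lend Q := locked (sc (t * x y) -
  \sum_(s in reflections G)
    sc (c s * Defs.root rts s y * x (coroot rts s)) * op_grp s).

Lemma dunkl_lin a y y' : dunkl (a *: y + y') = sc a * dunkl y + dunkl y'.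
Proof.
rewrite /dunkl -!lock op_skew_lin; try exact: skew_compat1.
rewrite mulrDr mulrBr addrACA -opprD !mulrA -!rmorphM [t * a]mulrC.
congr (_ - _); rewrite mulr_sumr -big_split; apply: eq_bigr => s sr /=.
rewrite linearP mulrA -rmorphM -mulrDl -rmorphD; congr (sc _ * _).
by rewrite mulrDr mulrCA.
Qed.

Lemma dunklZ a y : dunkl (a *: y) = sc a * dunkl y.
Proof.
have := dunkl_lin 1 0 0; rewrite scaler0 addr0 rmorph1 mul1r => e0.
have d0 : dunkl 0 = 0 by apply: (addrI (dunkl 0)); rewrite addr0.
by rewrite -[a *: y]addr0 dunkl_lin d0 addr0.
Qed.

Lemma dunklB y y' : dunkl (y - y') = dunkl y - dunkl y'.
Proof. by rewrite addrC -scaleN1r dunkl_lin rmorphN1 mulN1r addrC. Qed.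

Lemma dunkl_x y x : dunkl y * op_var ((0, x) : V) =
  op_var ((0, x) : V) * dunkl y + op_comm y x.
Proof.
have left_x g : gl_left g ((0, x) : V) = (0, x) by rewrite /gl_left linear0.
rewrite /dunkl /op_comm -!lock mulrBl mulrBr mulr_suml mulr_sumr addrACA -opprD.
rewrite -big_split /= -mulrA op_skew_var; last exact: skew_compat1.
rewrite left_x mulrDr !mulrA -rmorphM op_grp1 mulr1 [sc t * _]lend_scalC.
congr (_ - _); apply: eq_bigr => s sr.
rewrite -[LHS]mulrA op_skew_var; last exact: skew_compat_refl.
by rewrite left_x mulrDr !mulrA -rmorphM [sc _ * op_var _]lend_scalC.
Qed.

(** Of the two root values, one comes from the Dunkl operator of [y], the other from [reflectionE]
    applied to [y' - s y']. *)
Definition op_comm_y y y' : lend Q := \sum_(s in reflections G)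
  sc (c s * refl_coef rts s * (Defs.root rts s y * Defs.root rts s y')) *
  (op_var ((coroot rts s, 0) : V) * op_skew s (coroot rts s)).

Lemma op_comm_yC y y' : op_comm_y y y' = op_comm_y y' y.
Proof. by apply: eq_bigr => s _; rewrite [Defs.root rts s y * _]mulrC. Qed.

Lemma dunkl_y y y' : dunkl y * op_var ((y', 0) : V) =
  op_var ((y', 0) : V) * dunkl y + op_comm_y y y'.
Proof.
rewrite /dunkl -!lock mulrBl mulrBr mulr_suml mulr_sumr.
have -> : sc t * op_skew 1%g y * op_var ((y', 0) : V) =
    op_var ((y', 0) : V) * (sc t * op_skew 1%g y).
  rewrite -[LHS]mulrA op_skew_y; last exact: skew_compat1.
  by rewrite gl_val1 id_lfunE !mulrA lend_scalC.
rewrite -addrA; congr (_ + _).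
rewrite -!sumrN -big_split; apply: eq_bigr => s sr /=.
rewrite -[X in - X = _]mulrA op_skew_y; last exact: skew_compat_refl.
(* Passing [op_skew] turns [y'] into [s y']; the difference, a multiple of the coroot, produces the
   term of [op_comm_y]. *)
have y'E : (y', 0) = (refl_coef rts s * Defs.root rts s y') *: (coroot rts s, 0) +
    (gl_val s y', 0) :> V.
  congr (_, _); first by rewrite /= -(reflectionE rts two_neq0) // subrK.
  by rewrite /= scaler0 addr0.
rewrite [in RHS]y'E op_var_lin; set O := op_var (coroot rts s, 0).
set O' := op_var _; set T := op_skew _ _.
rewrite mulrDl opprD addrAC [sc _ * O * _]mulrA [sc _ * O]lend_scalC.
have -> : O * sc (refl_coef rts s * Defs.root rts s y') *
    sc (c s * Defs.root rts s y) * T = sc (c s * refl_coef rts s *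
    (Defs.root rts s y * Defs.root rts s y')) * (O * T).
  rewrite -[O * _ * _]mulrA -rmorphM -lend_scalC -mulrA; congr (sc _ * _).
  by rewrite mulrC mulrACA.
by rewrite addNr add0r !mulrA lend_scalC.
Qed.

Lemma dunkl_grp k y : op_grp k * dunkl y = dunkl (gl_val k y) * op_grp k.
Proof.
rewrite /dunkl -!lock mulrBr mulrBl; congr (_ - _).
  rewrite mulrA -lend_scalC -mulrA op_skew_grp; last exact: skew_compat1.
  by rewrite mulg1 mulgV mulrA.
(* Conjugation by [k] permutes the reflections and preserves [c]. *)
rewrite mulr_sumr mulr_suml [RHS](reindex_inj (conjg_inj k^-1%g)) /=.
apply: eq_big => [s|s sr]; rewrite conjgE invgK mulgA ?reflections_conj //.
have sr' : (k * s * k^-1)%g \in reflections G by rewrite reflections_conj.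
have sc_s := skew_compat_refl sr; have sc_s' := skew_compat_refl sr'.
rewrite c_inv //.
(* The root value is absorbed into the vector, so that only the product of root and coroot occurs
   and [root_coroot_conj] applies. *)
transitivity (sc (c s) * op_skew (k * s * k^-1)%g
    (Defs.root rts s y *: gl_val k (coroot rts s)) * op_grp k).
  rewrite [LHS]mulrA -lend_scalC -[LHS]mulrA op_skew_grp // op_skewZ.
    by rewrite rmorphM !mulrA.
  exact: skew_compat_conj.
by rewrite -(root_coroot_conj rts two_neq0) // op_skewZ // rmorphM !mulrA.
Qed.

Lemma dunkl_grpC s y : s \in reflections G ->
  dunkl y * op_grp s = op_grp s * dunkl y +
    sc (refl_coef rts s * Defs.root rts s y) * (dunkl (coroot rts s) * op_grp s).
Proof.
move=> sr; rewrite dunkl_grp [_ * (dunkl _ * _)]mulrA -dunklZ -mulrDl.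
by rewrite -(reflectionE rts two_neq0) // dunklB [_ + (_ - _)]addrC subrK.
Qed.

(** Moving [dunkl y] past [s] costs the Dunkl operator of [y - s y], a multiple of the coroot. The
    resulting correction is symmetric in [y] and [y']. *)
Lemma dunkl_op_comm y y' x : dunkl y * op_comm y' x =
  op_comm y' x * dunkl y - \sum_(s in reflections G)
    sc (c s * x (coroot rts s) * refl_coef rts s *
        (Defs.root rts s y * Defs.root rts s y')) *
    (dunkl (coroot rts s) * op_grp s).
Proof.
rewrite /op_comm -!lock mulrBr mulrBl -lend_scalC -addrA; congr (_ + _).
rewrite mulr_sumr mulr_suml -opprD -big_split; congr (- _).
apply: eq_bigr => s sr /=.
rewrite [LHS]mulrA -lend_scalC -[LHS]mulrA (dunkl_grpC y sr) mulrDr.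
congr (_ + _); first by rewrite mulrA.
rewrite [LHS]mulrA -rmorphM; congr (sc _ * _).
have reorder (d a a' b e : K) : d * a' * b * (e * a) = d * b * e * (a * a').
  by rewrite [d * a' * b]mulrAC -!mulrA; congr (_ * (_ * _)); rewrite mulrC mulrA.
exact: reorder.
Qed.

(** By the product rule the left side is [op_comm y x * dunkl y' + dunkl y * op_comm y' x].
    Reordering the second term by [dunkl_op_comm] makes the whole symmetric in [y] and [y']. *)
Lemma dunklM_x y y' x :
  dunkl y * dunkl y' * op_var ((0, x) : V) -
    op_var ((0, x) : V) * (dunkl y * dunkl y') =
  dunkl y' * dunkl y * op_var ((0, x) : V) -
    op_var ((0, x) : V) * (dunkl y' * dunkl y).
Proof.
have comm_x z z' : dunkl z * dunkl z' * op_var ((0, x) : V) -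
    op_var ((0, x) : V) * (dunkl z * dunkl z') =
    op_comm z x * dunkl z' + dunkl z * op_comm z' x.
  rewrite -[X in X - _]mulrA dunkl_x mulrDr [X in X + _ - _]mulrA dunkl_x mulrDl.
  by rewrite -[X in X + _ + _ - _]mulrA -[X in X - _]addrA [X in X - _]addrC addrK.
rewrite !comm_x !dunkl_op_comm !addrA [op_comm y x * _ + _]addrC; congr (_ - _).
by apply: eq_bigr => s _; rewrite [Defs.root rts s y * _]mulrC.
Qed.

Lemma op_skew_normal u k : (forall s b, skew_compat s b ->
    op_skew s b (smash_emb (sact m) u * smash_grp (sact m) k) = 0) ->
  forall y, dunkl y (smash_emb (sact m) u * smash_grp (sact m) k) = 0.
Proof.
move=> u0 y; rewrite /dunkl -!lock lend_subE lend_mulE u0; last exact: skew_compat1.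
rewrite linear0 sub0r lend_sumE big1 ?oppr0 // => s sr.
by rewrite lend_mulE u0 ?linear0 //; exact: skew_compat_refl.
Qed.

(** Elements without [x] enter through the property of being killed by all skew operators: it holds
    for scalars and, by [op_skew_y], is stable under multiplication by [y]. Factors [x] are then
    added one at a time, since [Z] commutes with them. *)
Lemma lend_smash_eq0 (Z : lend Q) :
    (forall x, Z * op_var ((0, x) : V) = op_var ((0, x) : V) * Z) ->
    (forall u k, (forall s b, skew_compat s b ->
        op_skew s b (smash_emb (sact m) u * smash_grp (sact m) k) = 0) ->
      Z (smash_emb (sact m) u * smash_grp (sact m) k) = 0) ->
  Z = 0.
Proof.
move=> Zx Z0.
suff Z_mul u k : Z (smash_emb (sact m) u * smash_grp (sact m) k) = 0.
  apply: lendP => q; rewrite lend_zeroE [q]smash_decomp.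
  by apply: etrans (linear_sum _ _ _ _) _; apply: big1 => k _; exact: Z_mul.
have var_mul v u' : smash_emb (sact m) (m v * u') * smash_grp (sact m) k =
    op_var v (smash_emb (sact m) u' * smash_grp (sact m) k).
  by rewrite op_var.unlock lmulE rmorphM mulrA.
elim/(@sym_normal_ind _ _ _ _ m (fun u => forall s b, skew_compat s b ->
  op_skew s b (smash_emb (sact m) u * smash_grp (sact m) k) = 0)) : u
  => [a s b sb|y u u0 s b sb|u|u u' Zu Zu'|x u Zu].
- rewrite smash_alg_mul linearZ; apply: etrans (scaler0 _ _); congr (_ *: _).
  apply/ffunP=> j; rewrite op_skewE [RHS]ffunE [smash_grp _ _ _]ffunE.
  by have [_ d1 _] := skew_derP m sb; case: eqP => _; rewrite ?linear0 // mulr1n.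
- by rewrite var_mul -lend_mulE op_skew_y // lend_mulE u0 // linear0.
- exact: Z0.
- rewrite rmorphD mulrDl.
  exact: etrans (linearD _ _ _) (etrans (congr2 +%R Zu Zu') (addr0 _)).
- by rewrite var_mul -lend_mulE Zx lend_mulE Zu linear0.
Qed.

Lemma dunklC y y' : dunkl y * dunkl y' = dunkl y' * dunkl y.
Proof.
apply/eqP; rewrite -subr_eq0; apply/eqP/lend_smash_eq0 => [x|u k u0].
  rewrite mulrBl mulrBr; apply/eqP.
  by rewrite subr_eq -[X in _ == X]addrA [X in _ == X]addrC -subr_eq dunklM_x addrC.
have d0 := op_skew_normal u0.
by rewrite lend_subE !lend_mulE !d0 !linear0 addr0.
Qed.

End DunklOperators.

(** * Universal properties *)

Section CherednikLift.
Variables (K : fieldType) (h : vectType K) (G : finGL h).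
Variables (rts : reflection_roots G) (c : G -> K).
Variables (B : pzRingType) (sc : {rmorphism K -> B}) (X : dual h -> B) (Y : h -> B).
Variables (U : G -> B) (z : B).
Local Notation V := (h * dual h)%type.

Hypothesis sc_comm : forall a b, GRing.comm (sc a) b.
Hypothesis z_comm : forall b, z * b = b * z.
Hypothesis X_lin : forall a x x', X (a *: x + x') = sc a * X x + X x'.
Hypothesis Y_lin : forall a y y', Y (a *: y + y') = sc a * Y y + Y y'.
Hypothesis U1 : U 1%g = 1.
Hypothesis UM : forall g k, U (g * k)%g = U g * U k.
Hypothesis UX : forall g x, U g * X x = X (gl_dual g x) * U g.
Hypothesis UY : forall g y, U g * Y y = Y (gl_val g y) * U g.

Let zero_of_lin (W : lmodType K) (f : W -> B) :
  (forall a w w', f (a *: w + w') = sc a * f w + f w') -> f 0 = 0.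
Proof. by move=> /(_ (-1) 0 0); rewrite scaler0 addr0 rmorphN1 mulN1r addNr. Qed.

Let phi (v : V) := Y v.1 + X v.2.

Let phi_lin a v w : phi (a *: v + w) = sc a * phi v + phi w.
Proof.
rewrite /phi -[(a *: v + w).1]/(a *: v.1 + w.1) -[(a *: v + w).2]/(a *: v.2 + w.2).
by rewrite Y_lin X_lin mulrDr addrACA.
Qed.

Let Uphi g v : U g * phi v = phi (gl_sum g v) * U g.
Proof. by rewrite /phi mulrDr mulrDl UX UY. Qed.

Let phi_x x : phi (0, x) = X x. Proof. by rewrite /phi (zero_of_lin Y_lin) add0r. Qed.
Let phi_y y : phi (y, 0) = Y y. Proof. by rewrite /phi (zero_of_lin X_lin) addr0. Qed.

Lemma smash_tens_lift : exists F : {rmorphism smash_tens G -> B},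
  [/\ forall a, F (st_scal G a) = sc a, forall g, F (st_grp g) = U g,
      forall x, F (st_x G x) = X x, forall y, F (st_y G y) = Y y
    & F (st_hbar G) = z].
Proof.
have [f [f_scal f_var]] := tens_lift_pz sc_comm phi_lin.
have Uf g a : U g * f a = f (tens_act g a) * U g.
  elim/tens_mul_ind: a => [a|a b fa fb|v a fa].
  - by rewrite tens_act_scal f_scal sc_comm.
  - by rewrite (rmorphD (tens_act g)) !rmorphD mulrDr mulrDl fa fb.
  - rewrite (rmorphM (tens_act g)) (rmorphM f) (rmorphM f) f_var tens_act_var f_var.
    by rewrite mulrA Uphi -mulrA fa mulrA.
have [F [F_emb F_grp]] := @smash_lift _ _ (tens_action G) B f U U1 UM Uf.
have zF a : z * F a = F a * z by exact: z_comm.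
have [FF [FF_C FF_X]] := poly_lift_pz zF.
exists FF; split => [a|g|x|y|].
- by rewrite FF_C F_emb f_scal.
- by rewrite FF_C F_grp.
- by rewrite FF_C F_emb f_var phi_x.
- by rewrite FF_C F_emb f_var phi_y.
- exact: FF_X.
Qed.

Hypothesis XC : forall x x', X x * X x' = X x' * X x.
Hypothesis YC : forall y y', Y y * Y y' = Y y' * Y y.

Lemma smash_sym_lift : (forall x y, X x * Y y = Y y * X x) ->
  exists F : {rmorphism smash (sym_action G) -> B},
  [/\ forall a, F (ss_scal G a) = sc a, forall g, F (ss_grp g) = U g,
      forall x, F (ss_x G x) = X x & forall y, F (ss_y G y) = Y y].
Proof.
move=> XY; have phiC v w : phi v * phi w = phi w * phi v.
  rewrite /phi !mulrDr !mulrDl XC YC !XY -!addrA; congr (_ + _).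
  by rewrite addrCA.
have [f [f_scal f_var]] := sym_lift_pz sc_comm phi_lin phiC.
have Uf g a : U g * f a = f (sym_act g a) * U g.
  elim/sym_mul_ind: a => [a|a b fa fb|v a fa].
  - by rewrite sym_act_scal f_scal sc_comm.
  - by rewrite (rmorphD (sym_act g)) !rmorphD mulrDr mulrDl fa fb.
  - rewrite (rmorphM (sym_act g)) (rmorphM f) (rmorphM f) f_var sym_act_var f_var.
    by rewrite mulrA Uphi -mulrA fa mulrA.
have [F [F_emb F_grp]] := @smash_lift _ _ (sym_action G) B f U U1 UM Uf.
exists F; split => [a|g|x|y].
- by rewrite F_emb f_scal.
- by rewrite F_grp.
- by rewrite F_emb f_var phi_x.
- by rewrite F_emb f_var phi_y.
Qed.

Hypothesis YX : forall y x, Y y * X x - X x * Y y =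
  z * sc (x y) - \sum_(s in reflections G)
    sc (c s * Defs.root rts s y * x (coroot rts s)) * U s.

Lemma cherednik_lift : exists F : {rmorphism cherednik rts c -> B},
  [/\ forall a, F (ch_proj rts c (st_scal G a)) = sc a,
      forall g, F (ch_proj rts c (st_grp g)) = U g,
      forall x, F (ch_proj rts c (st_x G x)) = X x,
      forall y, F (ch_proj rts c (st_y G y)) = Y y
    & F (ch_proj rts c (st_hbar G)) = z].
Proof.
have [F [F_scal F_grp F_x F_y F_hbar]] := smash_tens_lift.
have FME (a b : smash_tens G) a' b' : F a = a' -> F b = b' -> F (a * b) = a' * b'.
  by move=> <- <-; exact: rmorphM.
have FBE (a b : smash_tens G) a' b' : F a = a' -> F b = b' -> F (a - b) = a' - b'.
  by move=> <- <-; exact: rmorphB.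
(* The images are computed by composing equations: rewriting in the smash product
   over the tensor algebra does not terminate in practice. *)
have F_rel a : cherednik_rel rts c a -> F a = 0.
  case=> [x x'|y y'|y x].
  - have e := FBE _ _ _ _ (FME _ _ _ _ (F_x x) (F_x x')) (FME _ _ _ _ (F_x x') (F_x x)).
    by apply: etrans e _; rewrite XC subrr.
  - have e := FBE _ _ _ _ (FME _ _ _ _ (F_y y) (F_y y')) (FME _ _ _ _ (F_y y') (F_y y)).
    by apply: etrans e _; rewrite YC subrr.
  - have e1 := FBE _ _ _ _ (FME _ _ _ _ (F_y y) (F_x x)) (FME _ _ _ _ (F_x x) (F_y y)).
    have e2 : F (\sum_(s in reflections G)
        st_scal G (c s * Defs.root rts s y * x (coroot rts s)) * st_grp s) =
      \sum_(s in reflections G)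
        sc (c s * Defs.root rts s y * x (coroot rts s)) * U s.
      apply: etrans (rmorph_sum F _ _ _) _; apply: eq_bigr => s _.
      exact: FME (F_scal _) (F_grp s).
    have e3 := FBE _ _ _ _ (FME _ _ _ _ F_hbar (F_scal (x y))) e2.
    by apply: etrans (FBE _ _ _ _ e1 e3) _; rewrite YX subrr.
exists (rquot_lift F_rel); split=> *; apply: etrans (rquot_liftE F_rel _) _.
- exact: F_scal.
- exact: F_grp.
- exact: F_x.
- exact: F_y.
- exact: F_hbar.
Qed.

End CherednikLift.

(** * The representation by linear polynomials *)

Section LinearPolynomials.
Variable E : nzRingType.
Implicit Types a b d e : E.

Lemma linpoly_mul a b d e :
  (a%:P * 'X + b%:P) * (d%:P * 'X + e%:P) =
  (a * d)%:P * 'X * 'X + (a * e + b * d)%:P * 'X + (b * e)%:P :> {poly E}.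
Proof.
have XC (u : E) : 'X * u%:P = u%:P * 'X :> {poly E} by rewrite commr_polyX.
rewrite mulrDl !mulrDr !mulrA -[a%:P * 'X * d%:P]mulrA -[a%:P * 'X * e%:P]mulrA !XC.
by rewrite !mulrA -!polyCM polyCD mulrDl !addrA.
Qed.

Lemma linpoly_mulC a b e : a * e = e * a ->
  (a%:P * 'X + b%:P) * e%:P - e%:P * (a%:P * 'X + b%:P) = (b * e - e * b)%:P
  :> {poly E}.
Proof.
move=> ae; have XC (u : E) : 'X * u%:P = u%:P * 'X :> {poly E} by rewrite commr_polyX.
rewrite mulrDl mulrDr -mulrA XC !mulrA -!polyCM ae polyCB opprD addrACA.
by rewrite subrr add0r.
Qed.

Lemma linpoly_comm a b d e :
    a * d = d * a -> b * e = e * b -> a * e + b * d = d * b + e * a ->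
  (a%:P * 'X + b%:P) * (d%:P * 'X + e%:P) =
  (d%:P * 'X + e%:P) * (a%:P * 'X + b%:P) :> {poly E}.
Proof. by move=> ad be cross; rewrite !linpoly_mul ad be cross. Qed.

Lemma linpoly_conj g a a' b b' : g * a = a' * g -> g * b = b' * g ->
  g%:P * (a%:P * 'X + b%:P) = (a'%:P * 'X + b'%:P) * g%:P :> {poly E}.
Proof.
move=> ga gb; rewrite mulrDr mulrDl mulrA -!polyCM ga gb.
by rewrite -[_ * 'X * _]mulrA -commr_polyX mulrA -polyCM.
Qed.

Lemma linpoly_linear u a b d e :
  (u * a + d)%:P * 'X + (u * b + e)%:P =
  u%:P * (a%:P * 'X + b%:P) + (d%:P * 'X + e%:P) :> {poly E}.
Proof. by rewrite !polyCD !polyCM mulrDl mulrDr !mulrA addrACA. Qed.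

Lemma size_linpoly a b : (size (a%:P * 'X + b%:P : {poly E})%R <= 2)%N.
Proof.
rewrite size_MXaddC; case: ifP => // _; rewrite ltnS; exact: size_polyC_leq1.
Qed.

Lemma coef1_linpoly a b : (a%:P * 'X + b%:P : {poly E})`_1 = a.
Proof. by rewrite coefD coefMX !coefC addr0. Qed.

End LinearPolynomials.

Section DunklRepresentation.
Variables (K : fieldType) (h : vectType K) (G : finGL h).
Variables (rts : reflection_roots G) (c : G -> K) (t : K).
Hypothesis two_neq0 : 2 != 0 :> K.
Hypothesis c_inv : forall s g : G,
  s \in reflections G -> c (g * s * g^-1)%g = c s.
Variables (A : comAlgType K) (m : sym_model G A).
Local Notation Q := (smash (sact m)).
Local Notation V := (h * dual h)%type.
Local Notation E := (lend Q).

Lemma dunkl_rep : exists F : {rmorphism cherednik rts c -> {poly E}},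
  [/\ forall a, F (ch_proj rts c (st_scal G a)) = (lend_scal Q a)%:P,
      forall g, F (ch_proj rts c (st_grp g)) = (op_grp m g)%:P,
      forall x, F (ch_proj rts c (st_x G x)) = (op_var m ((0, x) : V))%:P,
      forall y, F (ch_proj rts c (st_y G y)) =
        (op_var m ((y, 0) : V))%:P * 'X + (dunkl rts c t m y)%:P
    & F (ch_proj rts c (st_hbar G)) = (lend_scal Q t)%:P].
Proof.
have x_lin a x x' : ((0, a *: x + x') : V) = a *: ((0, x) : V) + (0, x').
  by congr (_, _); rewrite /= scaler0 addr0.
have y_lin a (y y' : h) : ((a *: y + y', 0) : V) = a *: ((y, 0) : V) + (y', 0).
  by congr (_, _); rewrite /= scaler0 addr0.
have scC a (p : {poly E}) : (lend_scal Q a)%:P * p = p * (lend_scal Q a)%:P.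
  by apply/polyP=> n; rewrite coefCM coefMC; exact: lend_scalC.
apply: (@cherednik_lift _ _ _ rts c {poly E} (polyC \o lend_scal Q)
  (fun x => (op_var m ((0, x) : V))%:P)
  (fun y => (op_var m ((y, 0) : V))%:P * 'X + (dunkl rts c t m y)%:P)
  (fun g => (op_grp m g)%:P) (lend_scal Q t)%:P).
- by move=> a p; exact: scC.
- exact: scC.
- by move=> a x x'; rewrite x_lin op_var_lin polyCD polyCM.
- by move=> a y y'; rewrite y_lin op_var_lin dunkl_lin; exact: linpoly_linear.
- by rewrite op_grp1.
- by move=> g k; rewrite op_grpM polyCM.
- move=> g x; rewrite -!polyCM op_grp_var; congr (op_var m _ * _)%:P.
  by rewrite /gl_sum /= linear0.
- move=> g y; apply: linpoly_conj; last exact: dunkl_grp.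
  rewrite op_grp_var; congr (op_var m _ * _); rewrite /gl_sum /=; congr (_, _).
  by apply/lfunP=> u; rewrite gl_dualE !lfunE.
- by move=> x x'; rewrite -!polyCM op_varC.
(* The remaining condition, on the coefficient of ['X], is the symmetry of [op_comm_y]. *)
- move=> y y'; apply: linpoly_comm; first exact: op_varC; first exact: dunklC.
  by rewrite !(dunkl_y rts c t two_neq0) op_comm_yC addrCA.
- move=> y x; rewrite linpoly_mulC; last exact: op_varC.
  rewrite dunkl_x // addrAC subrr add0r /op_comm -lock.
  rewrite polyCB /= -!polyCM -rmorphM; congr (_ - _).
  by rewrite rmorph_sum; apply: eq_bigr => s _; rewrite -polyCM.
Qed.

End DunklRepresentation.

(** * The natural map to the associated graded ring *)

Section SmashTensor.
Variables (K : fieldType) (h : vectType K) (G : finGL h).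
Local Notation V := (h * dual h)%type.
Local Notation ST := (smash_tens G).

Let pair_x a (x x' : dual h) : ((0, a *: x + x') : V) = a *: ((0, x) : V) + (0, x').
Proof. by congr (_, _); rewrite /= scaler0 addr0. Qed.
Let pair_y a (y y' : h) : ((a *: y + y', 0) : V) = a *: ((y, 0) : V) + (y', 0).
Proof. by congr (_, _); rewrite /= scaler0 addr0. Qed.

Let emb (u : tens V) : ST := (smash_emb (tens_action G) u)%:P.
Let embD u v : emb (u + v) = emb u + emb v.
Proof. exact: (rmorphD (polyC \o smash_emb (tens_action G))). Qed.
Let embM u v : emb (u * v) = emb u * emb v.
Proof. exact: (rmorphM (polyC \o smash_emb (tens_action G))). Qed.
Let emb_lin a u v : emb (tens_var (a *: u + v)) =
  st_scal G a * emb (tens_var u) + emb (tens_var v).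
Proof.
apply: etrans (congr1 emb (tens_var_lin a u v)) _.
by apply: etrans (embD _ _) _; congr (_ + _); exact: embM.
Qed.

Let st_scal_morph : {rmorphism K -> ST} :=
  polyC \o (smash_emb (tens_action G) \o tens_scal V).

Lemma st_scal1 : st_scal G 1 = 1.
Proof. exact (rmorph1 st_scal_morph). Qed.
Lemma st_scalB a b : st_scal G (a - b) = st_scal G a - st_scal G b.
Proof. exact (rmorphB st_scal_morph a b). Qed.
Lemma st_scalM a b : st_scal G (a * b) = st_scal G a * st_scal G b.
Proof. exact (rmorphM st_scal_morph a b). Qed.

Lemma st_scal_comm a (q : ST) : st_scal G a * q = q * st_scal G a.
Proof.
apply/polyP=> n; apply: etrans (coefCM _ _ _) _; apply: etrans _ (esym (coefMC _ _ _)).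
apply: smash_emb_comm => [g|b]; [exact: tens_act_scal|exact: tens_scalC].
Qed.

Lemma st_hbar_comm (q : ST) : st_hbar G * q = q * st_hbar G.
Proof. by apply: esym; exact: commr_polyX. Qed.

Lemma st_x_lin a x x' : st_x G (a *: x + x') = st_scal G a * st_x G x + st_x G x'.
Proof.
exact (etrans (congr1 (fun v => emb (tens_var v)) (pair_x a x x')) (emb_lin a _ _)).
Qed.

Lemma st_y_lin a y y' : st_y G (a *: y + y') = st_scal G a * st_y G y + st_y G y'.
Proof.
exact (etrans (congr1 (fun v => emb (tens_var v)) (pair_y a y y')) (emb_lin a _ _)).
Qed.

Lemma st_grpM (g k : G) : st_grp (g * k)%g = st_grp g * st_grp k.
Proof.
have e := congr1 (fun f : smash (tens_action G) => f%:P) (smash_grpM (tens_action G) g k).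
exact: (etrans e (polyCM _ _)).
Qed.

Let grp_emb g u : st_grp g * emb u = emb (tens_act g u) * st_grp g.
Proof.
have e := congr1 (fun f : smash (tens_action G) => f%:P)
  (smash_grp_emb (tens_action G) g u).
exact: (etrans (esym (polyCM _ _)) (etrans e (polyCM _ _))).
Qed.

Lemma st_grp_x (g : G) x : st_grp g * st_x G x = st_x G (gl_dual g x) * st_grp g.
Proof.
have sumE : gl_sum g ((0, x) : V) = (0, gl_dual g x).
  by congr (_, _); exact: linear0.
have e := etrans (tens_act_var g ((0, x) : V)) (congr1 _ sumE).
exact (etrans (grp_emb g (tens_var ((0, x) : V))) (congr1 (fun u => emb u * st_grp g) e)).
Qed.

Lemma st_grp_y (g : G) y : st_grp g * st_y G y = st_y G (gl_val g y) * st_grp g.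
Proof.
have sumE : gl_sum g ((y, 0) : V) = (gl_val g y, 0).
  by congr (_, _); apply/lfunP=> u; rewrite gl_dualE !lfunE.
have e := etrans (tens_act_var g ((y, 0) : V)) (congr1 _ sumE).
exact (etrans (grp_emb g (tens_var ((y, 0) : V))) (congr1 (fun u => emb u * st_grp g) e)).
Qed.

End SmashTensor.

Section GradedLift.
Variables (K : fieldType) (h : vectType K) (G : finGL h).
Variables (rts : reflection_roots G) (c : G -> K).
Local Notation ST := (smash_tens G).
Variables (R : pzRingType) (p : {rmorphism ST -> R}) (gen : nat -> R -> Prop).
Hypothesis p_rel : forall a, cherednik_rel rts c a -> p a = 0.
Hypothesis p_surj : forall r, exists a, p a = r.
Hypothesis gen_scal : forall a, gen 0 (p (st_scal G a)).
Hypothesis gen_grp : forall g, gen 0 (p (st_grp g)).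
Hypothesis gen_x : forall x, gen 0 (p (st_x G x)).
Hypothesis gen_y : forall y, gen 1 (p (st_y G y)).
Local Notation F := (gen_fil gen).
Hypothesis hbar_fil : F 0 (p (st_hbar G)).

Let pM (a b : ST) : p (a * b) = p a * p b. Proof. exact: rmorphM. Qed.
Let pD (a b : ST) : p (a + b) = p a + p b. Proof. exact: rmorphD. Qed.
Let pB (a b : ST) : p (a - b) = p a - p b. Proof. exact: rmorphB. Qed.

Let p_eq (a b a' b' : ST) : cherednik_rel rts c (a * b - a' * b') ->
  p a * p b = p a' * p b'.
Proof.
move=> /p_rel e; apply/eqP; rewrite -subr_eq0; apply/eqP.
exact (etrans (esym (etrans (pB _ _) (congr2 (fun u v => u - v) (pM _ _) (pM _ _)))) e).
Qed.

Let cls n (x : R) (Fx : F n x) : gr F := gr_class Fx.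
Let gf n x (gx : gen n x) : F n x := gen_fil_gen gx.
Let C0 x (gx : gen 0 x) := cls (gf gx).
Let C1 x (gx : gen 1 x) := cls (gf gx).

(** The ring [R] is abstract so as to serve [H_c] and [H_{t,c}] alike. Classes of [x] and [y]
    commute because the commutator has degree 0 by the defining relation, while its class is taken
    in degree 1. *)
Lemma gr_smash_lift : exists xi : {rmorphism smash (sym_action G) -> gr F},
  [/\ forall a, xi (ss_scal G a) = gr_class (F := F) (gen_fil_gen (gen_scal a)),
      forall g, xi (ss_grp g) = gr_class (F := F) (gen_fil_gen (gen_grp g)),
      forall x, xi (ss_x G x) = gr_class (F := F) (gen_fil_gen (gen_x x))
    & forall y, xi (ss_y G y) = gr_class (F := F) (gen_fil_gen (gen_y y))].
Proof.
pose sc a := C0 (gen_scal a).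
have scB : zmod_morphism sc.
  move=> a b; rewrite /sc /C0 /cls.
  rewrite -(gr_classB _ _ (filB (gf (gen_scal a)) (gf (gen_scal b)))).
  by apply: gr_class_eq; exact (etrans (congr1 p (st_scalB G a b)) (pB _ _)).
have scM : monoid_morphism sc.
  split=> [|a b].
    rewrite -(gr_class1 (fil1 F)); apply: gr_class_eq.
    exact (etrans (congr1 p (st_scal1 G)) (rmorph1 p)).
  rewrite /sc /C0 /cls.
  rewrite -(gr_classM _ _ (filM (gf (gen_scal a)) (gf (gen_scal b)))).
  by apply: gr_class_eq; exact (etrans (congr1 p (st_scalM G a b)) (pM _ _)).
pose scm : {rmorphism K -> gr F} := HB.pack sc
  (GRing.isZmodMorphism.Build _ _ sc scB) (GRing.isMonoidMorphism.Build _ _ sc scM).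
have scC a b : GRing.comm (scm a) b.
  apply: gr_class_central => r; have [q <-] := p_surj r.
  exact (etrans (esym (pM _ _)) (etrans (congr1 p (st_scal_comm a q)) (pM _ _))).
have lin n (W : lmodType K) (f : W -> ST) (gw : forall w, gen n (p (f w))) :
    (forall a w w', f (a *: w + w') = st_scal G a * f w + f w') ->
    forall a w w', cls (gf (gw (a *: w + w'))) =
      scm a * cls (gf (gw w)) + cls (gf (gw w')).
  move=> flin a w w'.
  have Fm : F n (p (st_scal G a) * p (f w)).
    exact: (filM (m := 0) (gf (gen_scal a)) (gf (gw w))).
  have -> : scm a * cls (gf (gw w)) = cls Fm.
    by apply: esym; exact: (@gr_classM _ F 0 n).
  rewrite -(gr_classD _ _ (filD Fm (gf (gw w')))); apply: gr_class_eq.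
  exact (etrans (congr1 p (flin a w w')) (etrans (pD _ _) (congr1 (+%R^~ _) (pM _ _)))).
have X_lin := lin 0%N (dual h) (st_x G) gen_x (@st_x_lin K h G).
have Y_lin := lin 1%N h (st_y G) gen_y (@st_y_lin K h G).
have [|||||||xi [xi_s xi_u xi_x xi_y]] := @smash_sym_lift K h G (gr F) scm
    (fun x => C0 (gen_x x)) (fun y => C1 (gen_y y)) (fun g => C0 (gen_grp g))
    scC X_lin Y_lin; last by exists xi.
- by rewrite -(gr_class1 (fil1 F)); apply: gr_class_eq; exact: rmorph1.
- move=> g k; rewrite -(gr_classM _ _ (filM (gf (gen_grp g)) (gf (gen_grp k)))).
  by apply: gr_class_eq; exact (etrans (congr1 p (st_grpM g k)) (pM _ _)).
- move=> g x.
  rewrite -(gr_classM _ _ (filM (gf (gen_grp g)) (gf (gen_x x)))).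
  rewrite -(gr_classM _ _ (filM (gf (gen_x (gl_dual g x))) (gf (gen_grp g)))).
  apply: gr_class_eq.
  exact (etrans (esym (pM _ _)) (etrans (congr1 p (st_grp_x g x)) (pM _ _))).
- move=> g y.
  rewrite -(@gr_classM _ F 0 1 _ _ _ _ (filM (gf (gen_grp g)) (gf (gen_y y)))).
  rewrite -(@gr_classM _ F 1 0 _ _ _ _ (filM (gf (gen_y (gl_val g y))) (gf (gen_grp g)))).
  apply: gr_class_eq.
  exact (etrans (esym (pM _ _)) (etrans (congr1 p (st_grp_y g y)) (pM _ _))).
- by move=> x x'; apply: gr_class_comm; apply: p_eq; exact: rel_xx.
- by move=> y y'; apply: gr_class_comm; apply: p_eq; exact: rel_yy.
- move=> x y; apply/eqP; rewrite -subr_eq0; apply/eqP.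
  have Fxy : F 1 (p (st_x G x) * p (st_y G y)).
    exact: (filM (m := 0) (gf (gen_x x)) (gf (gen_y y))).
  have Fyx : F 1 (p (st_y G y) * p (st_x G x)).
    exact: (filM (n := 0) (gf (gen_y y)) (gf (gen_x x))).
  have -> : C0 (gen_x x) * C1 (gen_y y) = cls Fxy by apply: esym; exact: (@gr_classM _ F 0 1).
  have -> : C1 (gen_y y) * C0 (gen_x x) = cls Fyx by apply: esym; exact: (@gr_classM _ F 1 0).
  rewrite -(gr_classB _ _ (filB Fxy Fyx)); apply: (@gr_class_weak _ F 0) => //.
  rewrite -opprB; apply: filN.
  have := p_rel (rel_yx rts c y x); move/(etrans (esym (pB _ _)))/eqP; rewrite subr_eq0.
  move=> /eqP e.
  have -> : p (st_y G y) * p (st_x G x) - p (st_x G x) * p (st_y G y) =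
      p (st_y G y * st_x G x - st_x G x * st_y G y).
    exact (esym (etrans (pB _ _) (congr2 (fun u v => u - v) (pM _ _) (pM _ _)))).
  rewrite e; apply: (eq_ind_r (F 0%N) _ (pB _ _)); apply: filB.
    apply: (eq_ind_r (F 0%N) _ (pM _ _)).
    by apply: (filM (m := 0) (n := 0) hbar_fil); exact: gf.
  apply: (eq_ind_r (F 0%N) _ (rmorph_sum p _ _ _)); apply: fil_sum => s _.
  apply: (eq_ind_r (F 0%N) _ (pM _ _)).
  by apply: (filM (m := 0) (n := 0)); exact: gf.
Qed.

End GradedLift.

(** * The symmetric algebra *)

Section SymModule.
Variables (K : fieldType) (V : lmodType K).

(* Locked, so that mulrA and the like do not match inside a scaled element. *)
Fact sym_scale_key : unit. Proof. by []. Qed.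
Definition sym_scale : K -> sym V -> sym V :=
  locked_with sym_scale_key (fun a u => sym_scal V a * u).

Lemma sym_scale_def a u : sym_scale a u = sym_scal V a * u.
Proof. by rewrite /sym_scale unlock. Qed.

Lemma sym_scaleA a b u : sym_scale a (sym_scale b u) = sym_scale (a * b) u.
Proof. by rewrite !sym_scale_def rmorphM mulrA. Qed.
Lemma sym_scale1 : left_id 1 sym_scale.
Proof. by move=> u; rewrite !sym_scale_def rmorph1 mul1r. Qed.
Lemma sym_scaleDr : right_distributive sym_scale +%R.
Proof. by move=> a u v; rewrite !sym_scale_def mulrDr. Qed.
Lemma sym_scaleDl u : {morph sym_scale^~ u : a b / a + b}.
Proof. by move=> a b; rewrite !sym_scale_def rmorphD mulrDl. Qed.
HB.instance Definition _ := GRing.Zmodule_isLmodule.Build K (sym V)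
  sym_scaleA sym_scale1 sym_scaleDr sym_scaleDl.

Lemma sym_scaleE a (u : sym V) : a *: u = sym_scal V a * u.
Proof. exact: sym_scale_def. Qed.

Lemma sym_scalerAl a (u v : sym V) : a *: (u * v) = (a *: u) * v.
Proof. by rewrite !sym_scaleE mulrA. Qed.

HB.instance Definition _ :=
  GRing.LSemiModule_isLSemiAlgebra.Build K (sym V) sym_scalerAl.
HB.instance Definition _ := GRing.PzRing_hasCommutativeMul.Build (sym V) (@sym_mulC K V).
HB.instance Definition _ := GRing.Lalgebra_isComAlgebra.Build K (sym V).

Lemma sym_algE a : a%:A = sym_scal V a. Proof. by rewrite sym_scaleE mulr1. Qed.

End SymModule.

Section SymModel.
Variables (K : fieldType) (h : vectType K) (G : finGL h).
Local Notation V := (h * dual h)%type.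

Let sym_var_linear : linear (@sym_var K V).
Proof. by move=> a v w; rewrite sym_var_lin sym_scaleE. Qed.

Let sym_alg_ind (P : sym V -> Prop) : (forall a : K, P a%:A) ->
  (forall u v, P u -> P v -> P (u + v)) ->
  (forall v u, P u -> P (sym_var v * u)) -> forall u, P u.
Proof. by move=> Pa; apply: sym_mul_ind => a; rewrite -sym_algE. Qed.

Let sym_alg_lift (phi : V -> lend (sym V * sym V)%type) :
    (forall a v w, phi (a *: v + w) = lend_scal _ a * phi v + phi w) ->
    (forall v w, phi v * phi w = phi w * phi v) ->
  exists f : {rmorphism sym V -> lend (sym V * sym V)%type},
    (forall a, f a%:A = lend_scal _ a) /\ (forall v, f (sym_var v) = phi v).
Proof.
move=> phi_lin phiC.
have [f [f_scal f_var]] := sym_lift_pz (@lend_scalC K _) phi_lin phiC.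
by exists f; split=> // a; rewrite sym_algE.
Qed.

Let sym_act_alg (g : G) (a : K) : sym_action G g a%:A = a%:A.
Proof. by rewrite sym_algE; exact: sym_act_scal. Qed.

Definition sym_model_of : sym_model G (sym V) :=
  SymModel sym_var_linear sym_alg_ind sym_alg_lift sym_act_alg (@sym_act_var K h G).

Local Notation Q := (smash (sym_action G)).

Lemma smash_sym_ext (B : pzRingType) (f1 f2 : {rmorphism Q -> B}) :
    (forall a, f1 (ss_scal G a) = f2 (ss_scal G a)) ->
    (forall g, f1 (ss_grp g) = f2 (ss_grp g)) ->
    (forall x, f1 (ss_x G x) = f2 (ss_x G x)) ->
    (forall y, f1 (ss_y G y) = f2 (ss_y G y)) ->
  f1 =1 f2.
Proof.
move=> e_scal e_grp e_x e_y; apply: smash_ext => // a.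
pose j := smash_emb (sym_action G).
have e : f1 \o j =1 f2 \o j; last exact: (e a).
apply: (sym_ext (f := f1 \o j) (g := f2 \o j)) => [b|[y x]]; first exact: e_scal.
have -> : sym_var (y, x) = sym_var ((y, 0) : V) + sym_var ((0, x) : V).
  have := sym_var_lin 1 ((y, 0) : V) (0, x); rewrite rmorph1 mul1r scale1r => <-.
  by congr (sym_var (_, _)); rewrite /= ?addr0 ?add0r.
rewrite !rmorphD; congr (_ + _); [exact: e_y|exact: e_x].
Qed.

End SymModel.

(** * The PBW theorem *)

Lemma inj_surj_bijective (T U : Type) (f : T -> U) :
  injective f -> (forall y, exists x, f x = y) -> bijective f.
Proof.
move=> f_inj /choice[g fgK]; exists g => // x.
by apply: f_inj; rewrite fgK.
Qed.

Lemma poly_rmorph_ext (R : nzRingType) (B : pzRingType)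
    (f1 f2 : {rmorphism {poly R} -> B}) :
  (forall a, f1 a%:P = f2 a%:P) -> f1 'X = f2 'X -> f1 =1 f2.
Proof.
move=> eC eX; elim/poly_ind => [|p a ih]; first by rewrite !rmorph0.
by rewrite !rmorphD !rmorphM ih eX eC.
Qed.

(** Natural numbers suffice as evaluation points. A root at [k] splits off a linear factor, whose
    value at a larger [i] is the invertible scalar [sc (i - k)]; so the quotient vanishes from
    [k.+1] on and has smaller size. *)
Lemma poly_eq0_of_scalars (K : fieldType) (E : nzRingType) (sc : {rmorphism K -> E})
    (p : {poly E}) : (forall n, n.+1%:R != 0 :> K) ->
    (forall a b, GRing.comm (sc a) b) -> (forall a, p.[sc a] = 0) -> p = 0.
Proof.
move=> char0 scC p0; move: {2}(size p) (leqnn (size p)) => n.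
have {p0} : forall i, (0 <= i)%N -> p.[sc i%:R] = 0 by move=> i _.
elim: n 0%N p => [|n IH] k p p0 sp; first by apply/eqP; rewrite -size_poly_leq0.
have /factor_theorem[q pq] : root p (sc k%:R) by apply/rootP/p0.
suff q0 : q = 0 by rewrite pq q0 mul0r.
apply: (IH k.+1) => [i ki|].
  have := p0 i (ltnW ki); rewrite pq hornerM_comm; last by rewrite /comm_poly scC.
  rewrite hornerXsubC -rmorphB -natrB ?(ltnW ki) // => /(congr1 (fun e => e * sc (i - k)%:R^-1)).
  rewrite mul0r -mulrA -rmorphM divff ?rmorph1 ?mulr1 //.
  by have := char0 (i - k).-1; rewrite prednK // subn_gt0.
have [->|qn0] := eqVneq q 0; first by rewrite size_poly0.
by move: sp; rewrite pq size_Mmonic ?monicXsubC // size_XsubC addn2.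
Qed.

Section PBW.
Variables (K : fieldType) (h : vectType K) (G : finGL h).
Variables (rts : reflection_roots G) (c : G -> K).
Hypothesis char0 : forall n, n.+1%:R != 0 :> K.
Hypothesis c_inv : forall s g : G,
  s \in reflections G -> c (g * s * g^-1)%g = c s.
Local Notation V := (h * dual h)%type.
Local Notation Q := (smash (sym_action G)).
Local Notation m := (sym_model_of G).
Local Notation E := (lend (smash (sact m))).
Let L0 : {rmorphism smash (sact m) -> E} := @lmul K h G (sym V) m.
Let L : {rmorphism Q -> E} := L0.

Let L_scal a : L (ss_scal G a) = lend_scal _ a.
Proof.
apply: etrans (lmul_alg m a); congr (lmul (smash_emb _ _)).
by rewrite sym_algE.
Qed.
Let L_grp g : L (ss_grp g) = op_grp m g. Proof. by rewrite op_grp.unlock. Qed.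
Let L_x x : L (ss_x G x) = op_var m ((0, x) : V). Proof. by rewrite op_var.unlock. Qed.
Let L_y y : L (ss_y G y) = op_var m ((y, 0) : V). Proof. by rewrite op_var.unlock. Qed.

Let ch_rel0 a : cherednik_rel rts c a -> ch_proj rts c a = 0.
Proof.
move=> ra; rewrite -(rmorph0 (ch_proj rts c)); apply/rquot_projP; rewrite subr0.
exact: tsi_rel.
Qed.

Lemma pbw_at (t : K) : exists xi : {rmorphism Q -> gr (cht_fil rts c t)},
  [/\ natural_map_at xi, bijective xi
    & forall xi' : {rmorphism Q -> gr (cht_fil rts c t)},
        natural_map_at xi' -> xi' =1 xi].
Proof.
have cht_rel0 a : cherednik_rel rts c a -> cht_proj rts c t a = 0.
  by move=> ra; exact (etrans (congr1 _ (ch_rel0 ra)) (rmorph0 _)).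
have surj r : exists a, cht_proj rts c t a = r.
  by elim/rquot_ind: r => r; elim/rquot_ind: r => a; exists a.
have hbarE : cht_proj rts c t (st_hbar G) = cht_proj rts c t (st_scal G t).
  apply/rquot_projP; apply: tsi_rel.
  have -> : ch_proj rts c (st_hbar G) - ch_proj rts c (st_scal G t) =
     ch_proj rts c (st_hbar G - st_scal G t) by exact: esym (rmorphB _ _ _).
  exact: hbar_eq.
(* [cht_gen] does not list hbar; it has degree 0 because it equals the scalar [t]. *)
have hbar_fil : cht_fil rts c t 0 (cht_proj rts c t (st_hbar G)).
  by rewrite hbarE; exact: gen_fil_gen (cht_gen_scal _ _ _ _).
have [xi [xi_s xi_u xi_x xi_y]] := gr_smash_lift cht_rel0 surj
  (cht_gen_scal rts c t) (cht_gen_grp rts c t) (cht_gen_x rts c t)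
  (cht_gen_y rts c t) hbar_fil.
exists xi; split; first by split.
- have [F [F_s F_u F_x F_y F_h]] := dunkl_rep rts t (char0 1) c_inv m.
  have F_hbar a : hbar_rel t a -> F a = 0.
    case; apply: etrans (congr1 F (rmorphB _ _ _)) _.
    by rewrite rmorphB F_h F_s subrr.
  pose rho := rquot_lift F_hbar.
  have rhoE a : rho (cht_proj rts c t a) = F (ch_proj rts c a) by exact: rquot_liftE.
  have rho_s a := etrans (rhoE _) (F_s a).
  have rho_u g := etrans (rhoE _) (F_u g).
  have rho_x z := etrans (rhoE _) (F_x z).
  have rho_y y := etrans (rhoE _) (F_y y).
  have rho_gen n x : cht_gen n x -> (size (rho x) <= n.+1)%N.
    case=> [a|g|z|y].
    + by rewrite rho_s size_polyC_leq1.
    + by rewrite rho_u size_polyC_leq1.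
    + by rewrite rho_x size_polyC_leq1.
    + by rewrite rho_y size_linpoly.
  have [kappa kappaE] := symbol_map rho_gen.
  have kappa_eq n x (Fx : cht_fil rts c t n x) q p :
      xi q = gr_class Fx -> rho x = p -> kappa (xi q) = p`_n.
    by move=> -> <-; exact: kappaE.
  (* For generators of degree 0 the constant coefficient is read off, for [y] the coefficient of
     ['X], in which the Dunkl operator does not occur. *)
  have kappa_xi : kappa \o xi =1 L.
    apply: smash_sym_ext => [a|g|z|y].
    + by apply: etrans (kappa_eq _ _ _ _ _ (xi_s a) (rho_s a)) _; rewrite coefC L_scal.
    + by apply: etrans (kappa_eq _ _ _ _ _ (xi_u g) (rho_u g)) _; rewrite coefC L_grp.
    + by apply: etrans (kappa_eq _ _ _ _ _ (xi_x z) (rho_x z)) _; rewrite coefC L_x.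
    + by apply: etrans (kappa_eq _ _ _ _ _ (xi_y y) (rho_y y)) _; rewrite coef1_linpoly L_y.
  apply: inj_surj_bijective.
    move=> p q /(congr1 kappa) e; apply: (@lmul_inj _ _ _ _ m).
    exact: etrans (esym (kappa_xi p)) (etrans e (kappa_xi q)).
  apply: gr_surjective => n x gx; case: n x / gx => [a|g|z|y].
  + by exists (ss_scal G a).
  + by exists (ss_grp g).
  + by exists (ss_x G z).
  + by exists (ss_y G y).
- move=> xi' [xi's xi'u xi'x xi'y]; apply: smash_sym_ext => *.
  + by rewrite xi's xi_s.
  + by rewrite xi'u xi_u.
  + by rewrite xi'x xi_x.
  + by rewrite xi'y xi_y.
Qed.

Lemma pbw_hbar : exists xi : {rmorphism {poly Q} -> gr (ch_fil rts c)},
  [/\ natural_map xi, bijective xi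
    & forall xi' : {rmorphism {poly Q} -> gr (ch_fil rts c)},
        natural_map xi' -> xi' =1 xi].
Proof.
have surj r : exists a, ch_proj rts c a = r by elim/rquot_ind: r => a; exists a.
have hbar_fil : ch_fil rts c 0 (ch_proj rts c (st_hbar G)).
  exact: gen_fil_gen (ch_gen_hbar _ _).
have [xi0 [xi_s xi_u xi_x xi_y]] := gr_smash_lift ch_rel0 surj
  (ch_gen_scal rts c) (ch_gen_grp rts c) (ch_gen_x rts c)
  (ch_gen_y rts c) hbar_fil.
pose z : gr (ch_fil rts c) := gr_class (F := ch_fil rts c) (gen_fil_gen (ch_gen_hbar rts c)).
(* Centrality of hbar passes to its class, so [xi0] extends to polynomials in hbar. *)
have zC b : z * xi0 b = xi0 b * z.
  apply: gr_class_central => r; have [q <-] := surj r.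
  exact (etrans (esym (rmorphM _ _ _)) (etrans (congr1 _ (st_hbar_comm q)) (rmorphM _ _ _))).
have [xi [xiC xiX]] := poly_lift_pz zC.
have xi_nat : natural_map xi.
  split=> [a|g||x|y]; last 1 first.
  - exact: etrans (xiC _) (xi_y y).
  - exact: etrans (xiC _) (xi_s a).
  - exact: etrans (xiC _) (xi_u g).
  - exact: xiX.
  - exact: etrans (xiC _) (xi_x x).
exists xi; split=> //; last first.
  move=> xi' [xi's xi'u xi'h xi'x xi'y]; apply: poly_rmorph_ext => [a|].
    have e : xi' \o polyC =1 xi \o polyC; last exact: (e a).
    have [xis xiu _ xix xiy] := xi_nat.
    apply: smash_sym_ext => [b|g|x|y].
    + exact: etrans (xi's b) (esym (xis b)).
    + exact: etrans (xi'u g) (esym (xiu g)).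
    + exact: etrans (xi'x x) (esym (xix x)).
    + exact: etrans (xi'y y) (esym (xiy y)).
  exact: etrans xi'h (esym xiX).
(* Here [dunkl_rep] is used on [H_c] itself, with hbar acting as [t]; its symbol map is the left
   regular representation followed by evaluation at [t]. *)
have kappa_ex t : exists kappa : {rmorphism gr (ch_fil rts c) -> E},
    forall p : {poly Q}, kappa (xi p) = (map_poly L p).[lend_scal _ t].
  have [F [F_s F_u F_x F_y F_h]] := dunkl_rep rts t (char0 1) c_inv m.
  have F_gen n x : ch_gen n x -> (size (F x) <= n.+1)%N.
    case=> [a|g||x'|y].
    + by rewrite F_s size_polyC_leq1.
    + by rewrite F_u size_polyC_leq1.
    + by rewrite F_h size_polyC_leq1.
    + by rewrite F_x size_polyC_leq1.
    + by rewrite F_y size_linpoly.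
  have [kappa kappaE] := symbol_map F_gen.
  have kappa_eq n x (Fx : ch_fil rts c n x) (q : gr (ch_fil rts c)) p :
      q = gr_class Fx -> F x = p -> kappa q = p`_n.
    by move=> -> <-; exact: kappaE.
  have Lc : commr_rmorph L (lend_scal _ t) by move=> a; exact: lend_scalC.
  exists kappa => p.
  have e : kappa \o xi =1 horner_morph Lc; last exact: (e p).
  apply: poly_rmorph_ext => [a|]; last first.
    apply: etrans (kappa_eq _ _ _ _ _ xiX F_h) _.
    by apply: etrans _ (esym (horner_morphX Lc)); rewrite coefC.
  apply: etrans _ (esym (horner_morphC Lc a)).
  apply: etrans (congr1 kappa (xiC a)) _.
  have e : kappa \o xi0 =1 L; last exact: (e a).
  apply: smash_sym_ext => [b|g|x|y].
  + by apply: etrans (kappa_eq _ _ _ _ _ (xi_s b) (F_s b)) _; rewrite coefC L_scal.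
  + by apply: etrans (kappa_eq _ _ _ _ _ (xi_u g) (F_u g)) _; rewrite coefC L_grp.
  + by apply: etrans (kappa_eq _ _ _ _ _ (xi_x x) (F_x x)) _; rewrite coefC L_x.
  + by apply: etrans (kappa_eq _ _ _ _ _ (xi_y y) (F_y y)) _; rewrite coef1_linpoly L_y.
apply: inj_surj_bijective.
  apply: raddf_inj => p xip0.
  have Lp0 : map_poly L p = 0.
    apply: (poly_eq0_of_scalars char0 (@lend_scalC K _)) => t.
    have [kappa <-] := kappa_ex t.
    exact: etrans (congr1 kappa xip0) (rmorph0 kappa).
  apply: (map_inj_poly (f := L)); [exact: (@lmul_inj _ _ _ _ m)|exact: rmorph0|].
  by rewrite Lp0 rmorph0.
apply: gr_surjective => n x gx; case: n x / gx => [a|g||x|y].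
- by exists (ss_scal G a)%:P; case: xi_nat.
- by exists (ss_grp g)%:P; case: xi_nat.
- by exists 'X; case: xi_nat.
- by exists (ss_x G x)%:P; case: xi_nat.
- by exists (ss_y G y)%:P; case: xi_nat.
Qed.

End PBW.

Theorem proposition3p5 (R : realType) (h : vectType R[i]) (G : finGL h)
    (rts : reflection_roots G) (c : G -> R[i])
    (c_inv : forall s g : G, s \in reflections G -> c (g * s * g^-1)%g = c s) :
  (exists xi : {rmorphism {poly smash (sym_action G)} -> gr (ch_fil rts c)},
     [/\ natural_map xi, bijective xi
       & forall xi' : {rmorphism {poly smash (sym_action G)} -> gr (ch_fil rts c)},
           natural_map xi' -> xi' =1 xi])
  /\
  (forall t : R[i],
   exists xi : {rmorphism smash (sym_action G) -> gr (cht_fil rts c t)},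
     [/\ natural_map_at xi, bijective xi
       & forall xi' : {rmorphism smash (sym_action G) -> gr (cht_fil rts c t)},
           natural_map_at xi' -> xi' =1 xi]).
Proof.
have char0 n : n.+1%:R != 0 :> R[i] by rewrite Num.Theory.pnatr_eq0.
by split=> [|t]; [exact: pbw_hbar|exact: pbw_at].
Qed.
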